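(* Let $E$ be a Riesz space and let $F$ be a Banach lattice. Then an order bounded linear operator $T\colon E\to F$ is disjointness preserving if and only if its second adjoint $T^{\sim\sim}\colon E^{\sim\sim}\to F^{**}$ is disjointness preserving.
   Context: Riesz spaces and Banach lattices are real; $E$ is not assumed Archimedean. For a Riesz space $E$, $E^\sim$ is its order dual (order bounded linear functionals) and $E^{\sim\sim}=(E^\sim)^\sim$. For a Banach lattice $F$, the order dual coincides with the topological dual, $F^\sim=F^*$, so $F^{\sim\sim}=F^{**}$. For an order bounded linear operator $T\colon E\to F$, its order adjoint is $T^\sim\colon F^\sim\to E^\sim$, $T^\sim(y^\sim)=y^\sim\circ T$, and $T^{\sim\sim}=(T^\sim)^\sim$. Vectors $x,y$ are disjoint, $x\perp y$, if $|x|\wedge|y|=0$. A linear operator $T$ between Riesz spaces is disjointness preserving if $T(x)\perp T(y)$ whenever $x\perp y$. *)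

(* Defs.v *)
From HB Require Import structures.
From mathcomp Require Import all_boot all_order all_algebra.
From mathcomp Require Import all_classical all_reals topology normedtype.
From mathcomp Require Import lra.
Set Implicit Arguments.
Unset Strict Implicit.
Unset Printing Implicit Defensive.
Import Order.TTheory GRing.Theory Num.Theory.
Import numFieldNormedType.Exports.
Local Open Scope classical_set_scope.
Local Open Scope ring_scope.

Reserved Notation "x <=v y" (at level 70, y at next level).
Reserved Notation "x \meet y" (at level 48, left associativity).
Reserved Notation "x \join y" (at level 52, left associativity).

(* The order is a field of the mixin instead of an [Order.Lattice ring_display]
   structure: a join of the latter with [GRing.Zmodule], or of an order with a
   norm, would have to sit below [Num.RealDomain] and [Num.NumDomain] in the
   hierarchy, which is already closed. *)
HB.mixin Record isRieszSpace (R : realType) E of GRing.Lmodule R E := {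
  vle : rel E ;
  vmeet : E -> E -> E ;
  vjoin : E -> E -> E ;
  vle_refl : reflexive vle ;
  vle_anti : antisymmetric vle ;
  vle_trans : transitive vle ;
  vle_meet : forall x y z : E, vle z (vmeet x y) = vle z x && vle z y ;
  vjoin_le : forall x y z : E, vle (vjoin x y) z = vle x z && vle y z ;
  vle_add : forall z x y : E, vle x y -> vle (z + x) (z + y) ;
  vscale_ge0 : forall (a : R) (x : E), 0 <= a -> vle 0 x -> vle 0 (a *: x)
}.

#[short(type="rieszSpaceType")]
HB.structure Definition RieszSpace (R : realType) :=
  { E of isRieszSpace R E & GRing.Lmodule R E }.

Notation "x <=v y" := (vle x y) : ring_scope.
Notation "x \meet y" := (vmeet x y) : ring_scope.
Notation "x \join y" := (vjoin x y) : ring_scope.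

Definition modulus (R : realType) (E : rieszSpaceType R) (x : E) : E :=
  x \join (- x).

Definition disjoint_vec (R : realType) (E : rieszSpaceType R) (x y : E) : Prop :=
  modulus x \meet modulus y = 0.

HB.mixin Record isBanachLattice (R : realType) F
    of CompleteNormedModule R F & RieszSpace R F := {
  norm_monotone : forall x y : F, modulus x <=v modulus y -> `|x| <= `|y|
}.

#[short(type="banachLatticeType")]
HB.structure Definition BanachLattice (R : realType) :=
  { F of isBanachLattice R F & CompleteNormedModule R F & RieszSpace R F }.

Section RegularRiesz.
Variable R : realType.
Implicit Types x y z : R^o.
Let rle : rel R^o := fun x y => (x : R) <= y.

Fact regular_le_refl : reflexive rle. Proof. exact: (@lexx _ R). Qed.
Fact regular_le_anti : antisymmetric rle. Proof. exact: (@le_anti _ R). Qed.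
Fact regular_le_trans : transitive rle. Proof. exact: (@le_trans _ R). Qed.

Fact regular_le_meet x y z :
  rle z (Num.min (x : R) y) = rle z x && rle z y.
Proof. exact: (@le_min _ R). Qed.

Fact regular_join_le x y z :
  rle (Num.max (x : R) y) z = rle x z && rle y z.
Proof. exact: (@ge_max _ R). Qed.

Fact regular_le_add z x y : rle x y -> rle (z + x) (z + y).
Proof. by rewrite /rle (@lerD2l R). Qed.

Fact regular_scale_ge0 (a : R) x : 0 <= a -> rle 0 x -> rle 0 (a *: x).
Proof. exact: (@mulr_ge0 R). Qed.

HB.instance Definition _ :=
  isRieszSpace.Build R R^o regular_le_refl regular_le_anti regular_le_trans
    regular_le_meet regular_join_le regular_le_add regular_scale_ge0.
End RegularRiesz.


Definition order_bounded (R : realType) (E F : rieszSpaceType R) (T : E -> F) :=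
  forall a b : E, exists c d : F,
    forall x : E, a <=v x -> x <=v b -> c <=v T x /\ T x <=v d.

Record order_bounded_operator (R : realType) (E F : rieszSpaceType R) :=
  OrderBoundedOperator {
    ob_fun :> E -> F ;
    ob_linear : linear ob_fun ;
    ob_bounded : order_bounded ob_fun
  }.

HB.instance Definition _ (R : realType) (E F : rieszSpaceType R)
    (T : order_bounded_operator E F) :=
  GRing.isLinear.Build R E F *:%R T (ob_linear T).

(* On a Banach lattice every order bounded functional is continuous and
   conversely, so for [F : banachLatticeType R] this is also the topological
   dual [F^*], and [order_dual (order_dual F)] is [F^**]. *)
Definition order_dual (R : realType) (E : rieszSpaceType R) : Type :=
  order_bounded_operator E R^o.

Section RieszTheory.
Variables (R : realType) (E : rieszSpaceType R).
Implicit Types x y z a b c : E.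

Lemma vlexx x : x <=v x. Proof. exact: vle_refl. Qed.

Lemma vle_tr y x z : x <=v y -> y <=v z -> x <=v z.
Proof. exact: vle_trans. Qed.

Lemma vle_eq x y : x <=v y -> y <=v x -> x = y.
Proof. by move=> xy yx; apply: vle_anti; rewrite xy. Qed.

Lemma vle_add2l z x y : (z + x <=v z + y) = (x <=v y).
Proof.
apply/idP/idP; last exact: vle_add.
by move=> /(vle_add (- z)); rewrite !addKr.
Qed.

Lemma vle_add2r z x y : (x + z <=v y + z) = (x <=v y).
Proof. by rewrite ![_ + z]addrC vle_add2l. Qed.

Lemma vsubr_ge0 x y : (0 <=v y - x) = (x <=v y).
Proof. by rewrite -(vle_add2r x) add0r subrK. Qed.

Lemma vle_opp x y : (- x <=v - y) = (y <=v x).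
Proof. by rewrite -vsubr_ge0 opprK addrC vsubr_ge0. Qed.

Lemma vadd_ge0 x y : 0 <=v x -> 0 <=v y -> 0 <=v x + y.
Proof. by move=> x0 y0; apply: (vle_tr x0); rewrite -{1}[x]addr0 vle_add2l. Qed.

Lemma vle_scale (k : R) x y : 0 <= k -> x <=v y -> k *: x <=v k *: y.
Proof.
by move=> k0 xy; rewrite -vsubr_ge0 -scalerBr vscale_ge0// vsubr_ge0.
Qed.

Lemma vjoin_l x y : x <=v x \join y.
Proof. by have := vlexx (x \join y); rewrite vjoin_le => /andP[]. Qed.

Lemma vjoin_r x y : y <=v x \join y.
Proof. by have := vlexx (x \join y); rewrite vjoin_le => /andP[]. Qed.

Lemma vmeet_l x y : x \meet y <=v x.
Proof. by have := vlexx (x \meet y); rewrite vle_meet => /andP[]. Qed.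

Lemma vmeet_r x y : x \meet y <=v y.
Proof. by have := vlexx (x \meet y); rewrite vle_meet => /andP[]. Qed.

Lemma vadd_join z x y : z + (x \join y) = (z + x) \join (z + y).
Proof.
apply: vle_eq; last by rewrite vjoin_le !vle_add2l vjoin_l vjoin_r.
rewrite -(vle_add2l (- z)) addKr vjoin_le.
rewrite -(vle_add2l z x) -(vle_add2l z y) !addrA !addrN !add0r.
by rewrite vjoin_l vjoin_r.
Qed.

Lemma vpos_partE x : x = (x \join 0) - ((- x) \join 0).
Proof.
have -> : x \join 0 = x + ((- x) \join 0).
  by rewrite vadd_join subrr addr0; apply: vle_eq;
    rewrite vjoin_le vjoin_l vjoin_r.
by rewrite addrK.
Qed.

Lemma modulus_ge x : x <=v modulus x. Proof. exact: vjoin_l. Qed.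
Lemma modulus_geN x : - x <=v modulus x. Proof. exact: vjoin_r. Qed.

Lemma modulus_ge0 x : 0 <=v modulus x.
Proof.
have h : 0 <=v modulus x + modulus x.
  rewrite -(subrr x); apply: (@vle_tr (modulus x - x)).
    by rewrite vle_add2r modulus_ge.
  by rewrite vle_add2l modulus_geN.
have -> : modulus x = 2^-1 *: (modulus x + modulus x).
  by rewrite scalerDr -scalerDl (_ : 2^-1 + 2^-1 = 1 :> R) ?scale1r//; lra.
by rewrite vscale_ge0// invr_ge0.
Qed.

Lemma modulus_le x y : x <=v y -> - x <=v y -> modulus x <=v y.
Proof. by rewrite /modulus vjoin_le => -> ->. Qed.

Lemma modulusD x y : modulus (x + y) <=v modulus x + modulus y.
Proof.
apply: modulus_le.
  apply: (@vle_tr (modulus x + y)).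
    by rewrite vle_add2r modulus_ge.
  by rewrite vle_add2l modulus_ge.
rewrite opprD; apply: (@vle_tr (modulus x - y)).
  by rewrite vle_add2r modulus_geN.
by rewrite vle_add2l modulus_geN.
Qed.

Lemma modulusZ (k : R) x : 0 <= k -> modulus (k *: x) = k *: modulus x.
Proof.
rewrite le_eqVlt => /predU1P[<-|k0].
  rewrite !scale0r; apply: vle_eq; last exact: modulus_ge0.
  by apply: modulus_le; rewrite ?oppr0 vlexx.
have h (l : R) y : 0 < l -> modulus (l *: y) <=v l *: modulus y.
  move=> /ltW l0; apply: modulus_le; first by rewrite vle_scale// modulus_ge.
  by rewrite -scalerN vle_scale// modulus_geN.
apply: vle_eq; first exact: h.
have := @h k^-1 (k *: x); rewrite invr_gt0 => /(_ k0).
move=> /(@vle_scale k _ _ (ltW k0)).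
by rewrite !scalerA mulVf ?gt_eqF// divff ?gt_eqF// !scale1r.
Qed.

Lemma riesz_decomp y a b : 0 <=v y -> 0 <=v a -> 0 <=v b -> y <=v a + b ->
  exists u v, [/\ y = u + v, 0 <=v u, u <=v a, 0 <=v v & v <=v b].
Proof.
move=> y0 a0 b0 yab; exists (y \meet a), (y - (y \meet a)).
rewrite vle_meet y0 a0 vmeet_r vsubr_ge0 vmeet_l; split=> //.
  by rewrite addrC subrK.
rewrite -(vle_add2r (y \meet a)) subrK -(vle_add2l (- b)) addKr vle_meet.
rewrite -(vle_add2l b _ y) -(vle_add2l b _ a) !addrA !addrN !add0r.
by rewrite [b + a]addrC yab andbT -{1}[y]add0r vle_add2r.
Qed.

Lemma vsum_ge0 (s : seq E) : all (vle 0) s -> 0 <=v \sum_(y <- s) y.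
Proof.
elim: s => [|y s IH] /=; first by rewrite big_nil vlexx.
by move=> /andP[y0 /IH s0]; rewrite big_cons vadd_ge0.
Qed.

End RieszTheory.

Section OrderDualBasic.
Variables (R : realType) (E : rieszSpaceType R).
Implicit Types (f g h : order_dual E) (x y : E).

Lemma ob_ext (F : rieszSpaceType R) (S T : order_bounded_operator E F) :
  S =1 T -> S = T.
Proof.
case: S T => [s sl sb] [t tl tb] /= /funext st.
by subst t; congr OrderBoundedOperator; exact: Prop_irrelevance.
Qed.

Lemma dualD f x y : (f (x + y) : R) = (f x : R) + (f y : R).
Proof. exact: (raddfD (ob_fun f : {linear E -> R^o})). Qed.

Lemma dualN f x : (f (- x) : R) = - (f x : R).
Proof. exact: (raddfN (ob_fun f : {linear E -> R^o})). Qed.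

Lemma dualZ f (k : R) x : (f (k *: x) : R) = k * (f x : R).
Proof. exact: (linearZZ (ob_fun f : {linear E -> R^o})). Qed.

Lemma dual0 f : (f 0 : R) = 0.
Proof. exact: (raddf0 (ob_fun f : {linear E -> R^o})). Qed.

Lemma dual_boundedP f (a b : E) :
  exists M : R, forall x, a <=v x -> x <=v b -> `|f x : R| <= M.
Proof.
have [c [d cd]] := ob_bounded f a b.
exists (`|c : R| + `|d : R|) => x ax xb.
have [cx xd] : ((c : R) <= f x) /\ ((f x : R) <= d) by exact: cd.
rewrite ler_norml; apply/andP; split.
  by have := ler_norm (- (c : R)); have := normr_ge0 (d : R); rewrite normrN; lra.
by have := ler_norm (d : R); have := normr_ge0 (c : R); lra.
Qed.

Lemma mk_bounded (f : E -> R^o) :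
  (forall a b : E, exists M : R, forall x, a <=v x -> x <=v b -> `|f x : R| <= M) ->
  order_bounded f.
Proof.
move=> H a b; have [M HM] := H a b; exists (- M), M => x ax xb.
have := HM x ax xb; rewrite ler_norml => /andP[? ?]; split; assumption.
Qed.

Fact dual_add_linear f g : linear (fun x => (f x + g x : R^o)).
Proof. by move=> k x y; rewrite !linearP/= scalerDr addrACA. Qed.

Fact dual_add_bounded f g : order_bounded (fun x => (f x + g x : R^o)).
Proof.
apply: mk_bounded => a b.
have [M HM] := dual_boundedP f a b; have [N HN] := dual_boundedP g a b.
exists (M + N) => x ax xb; apply: (le_trans (@ler_normD R R (f x) (g x))).
by apply: lerD; [exact: HM|exact: HN].
Qed.

Definition dual_add f g : order_dual E :=
  OrderBoundedOperator (dual_add_linear f g) (dual_add_bounded f g).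

Fact dual_scale_linear (k : R) f : linear (fun x => (k *: f x : R^o)).
Proof. by move=> l x y; rewrite linearP scalerDr !scalerA mulrC. Qed.

Fact dual_scale_bounded (k : R) f : order_bounded (fun x => (k *: f x : R^o)).
Proof.
apply: mk_bounded => a b.
have [M HM] := dual_boundedP f a b; exists (`|k| * M) => x ax xb.
rewrite (_ : `|_| = `|k| * `|f x : R|); last exact: (@normrM R).
by apply: ler_wpM2l => //; exact: HM.
Qed.

Definition dual_scale (k : R) f : order_dual E :=
  OrderBoundedOperator (dual_scale_linear k f) (dual_scale_bounded k f).

Definition dual_zero : order_dual E.
Proof.
refine (@OrderBoundedOperator R E R^o (fun=> 0) _ _).
- by move=> k x y; rewrite scaler0 addr0.
- by move=> a b; exists 0, 0 => x _ _; split; exact: vlexx.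
Defined.

HB.instance Definition _ := gen_eqMixin (order_dual E).
HB.instance Definition _ := gen_choiceMixin (order_dual E).

Fact dual_addA : associative dual_add.
Proof. by move=> f g h; apply: ob_ext => x /=; rewrite addrA. Qed.
Fact dual_addC : commutative dual_add.
Proof. by move=> f g; apply: ob_ext => x /=; rewrite addrC. Qed.
Fact dual_add0 : left_id dual_zero dual_add.
Proof. by move=> f; apply: ob_ext => x /=; rewrite add0r. Qed.
Fact dual_addN : left_inverse dual_zero (dual_scale (-1)) dual_add.
Proof. by move=> f; apply: ob_ext => x /=; rewrite scaleN1r addNr. Qed.

HB.instance Definition _ :=
  GRing.isZmodule.Build (order_dual E) dual_addA dual_addC dual_add0 dual_addN.

Fact dual_scaleA (k l : R) f :
  dual_scale k (dual_scale l f) = dual_scale (k * l) f.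
Proof. by apply: ob_ext => x /=; rewrite scalerA. Qed.
Fact dual_scale1 : left_id 1 dual_scale.
Proof. by move=> f; apply: ob_ext => x /=; rewrite scale1r. Qed.
Fact dual_scaleDr : right_distributive dual_scale +%R.
Proof. by move=> k f g; apply: ob_ext => x /=; rewrite scalerDr. Qed.
Fact dual_scaleDl f : {morph dual_scale^~ f : k l / k + l}.
Proof. by move=> k l; apply: ob_ext => x /=; rewrite scalerDl. Qed.

HB.instance Definition _ :=
  GRing.Zmodule_isLmodule.Build R (order_dual E)
    dual_scaleA dual_scale1 dual_scaleDr dual_scaleDl.

Lemma dual_addE f g x : ((f + g) x : R) = (f x : R) + (g x : R).
Proof. by []. Qed.

Lemma dual_zeroE x : ((0 : order_dual E) x : R) = 0.
Proof. by []. Qed.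

Lemma dual_oppE f x : ((- f) x : R) = - (f x : R).
Proof. by rewrite /= scaleN1r. Qed.

Lemma dual_scaleE k f x : ((k *: f) x : R) = k * (f x : R).
Proof. by []. Qed.

End OrderDualBasic.

(* Riesz-Kantorovich: for [p] subadditive on the positive cone, the supremum of
   the sums [\sum_i p y_i] over finite decompositions [x = \sum_i y_i] into
   positive vectors is additive in [x]; its linear extension is the least
   functional that dominates [p] on the cone. *)
Section PartitionSup.
Variables (R : realType) (E : rieszSpaceType R) (p : E -> R) (f : order_dual E).
Implicit Types (x y a b : E) (s : seq E).

Definition partition_of x : set (seq E) :=
  [set s | all (vle 0) s /\ \sum_(y <- s) y = x].

Definition partition_sup x : R :=
  sup [set \sum_(y <- s) p y | s in partition_of x].

Hypothesis psub : forall a b, 0 <=v a -> 0 <=v b -> p (a + b) <= p a + p b.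
Hypothesis pscale : forall (k : R) a, 0 < k -> 0 <=v a -> p (k *: a) = k * p a.
Hypothesis pbound : forall x, 0 <=v x ->
  exists M, forall s, partition_of x s -> \sum_(y <- s) p y <= M.
Hypothesis fp : forall x, 0 <=v x -> (f x : R) <= p x.

Let H := partition_sup.

Lemma partition_sup_ge x s : 0 <=v x -> partition_of x s ->
  \sum_(y <- s) p y <= H x.
Proof.
move=> x0 sx; apply: ub_le_sup; last by exists s.
by have [M HM] := pbound x0; exists M => _ [t tx <-]; exact: HM.
Qed.

Lemma partition_sup_le x M : 0 <=v x ->
  (forall s, partition_of x s -> \sum_(y <- s) p y <= M) -> H x <= M.
Proof.
move=> x0 HM; apply: ge_sup; last by move=> _ [s sx <-]; exact: HM.
exists (\sum_(y <- [:: x]) p y), [:: x] => //; split; first by rewrite /= x0.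
by rewrite big_seq1.
Qed.

Lemma partition_sup_dominates x : 0 <=v x -> p x <= H x.
Proof.
move=> x0; have := @partition_sup_ge x [:: x] x0; rewrite big_seq1; apply.
by split; rewrite ?big_seq1//= x0.
Qed.

Lemma partition_split s a b : all (vle 0) s -> 0 <=v a -> 0 <=v b ->
  \sum_(y <- s) y = a + b ->
  exists s1 s2, [/\ partition_of a s1, partition_of b s2 &
    \sum_(y <- s) p y <= \sum_(y <- s1) p y + \sum_(y <- s2) p y].
Proof.
elim: s a b => [|y s IH] a b /=.
  move=> _ a0 b0; rewrite big_nil => /esym ab.
  have az : a = 0.
    apply: vle_eq => //; rewrite -vle_opp oppr0.
    by rewrite (_ : - a = b)// -[b](addKr a) ab addr0.
  have bz : b = 0 by rewrite -ab az add0r.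
  exists [::], [::]; rewrite az bz; split; try by split; rewrite ?big_nil.
  by rewrite !big_nil addr0.
move=> /andP[y0 s0] a0 b0; rewrite big_cons => yab.
have yle : y <=v a + b by rewrite -yab -{1}[y]addr0 vle_add2l vsum_ge0.
have [u [v [yE u0 ua v0 vb]]] := riesz_decomp y0 a0 b0 yle.
have sE : \sum_(j <- s) j = (a - u) + (b - v).
  by rewrite addrACA -opprD -yE -yab addrC addKr.
have [||s1 [s2 [[p1 e1] [p2 e2] le12]]] := IH _ _ s0 _ _ sE.
- by rewrite vsubr_ge0.
- by rewrite vsubr_ge0.
exists (u :: s1), (v :: s2); split.
- by split; rewrite /= ?u0// big_cons e1 addrC subrK.
- by split; rewrite /= ?v0// big_cons e2 addrC subrK.
by rewrite !big_cons; have := psub u0 v0; rewrite -yE; lra.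
Qed.

Lemma partition_supD a b : 0 <=v a -> 0 <=v b -> H (a + b) = H a + H b.
Proof.
move=> a0 b0; apply/le_anti/andP; split.
  apply: partition_sup_le => [|s [s0 sE]]; first exact: vadd_ge0.
  have [s1 [s2 [h1 h2 h]]] := partition_split s0 a0 b0 sE.
  by have := partition_sup_ge a0 h1; have := partition_sup_ge b0 h2; lra.
suff : H a <= H (a + b) - H b by lra.
apply: partition_sup_le => // s [s0 sE].
suff : H b <= H (a + b) - \sum_(y <- s) p y by lra.
apply: partition_sup_le => // t [t0 tE].
have st : partition_of (a + b) (s ++ t).
  by split; rewrite ?all_cat ?s0// big_cat /= sE tE.
have := partition_sup_ge (vadd_ge0 a0 b0) st; rewrite big_cat /=; lra.
Qed.

Lemma partition_sup0 : H 0 = 0.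
Proof. by have := partition_supD (vlexx 0) (vlexx 0); rewrite addr0; lra. Qed.

Lemma partition_supZ (k : R) a : 0 <= k -> 0 <=v a -> H (k *: a) = k * H a.
Proof.
rewrite le_eqVlt => /predU1P[<-|k0] a0.
  by rewrite scale0r mul0r partition_sup0.
have h (l : R) x : 0 < l -> 0 <=v x -> l * H x <= H (l *: x).
  move=> l0 x0; rewrite mulrC -ler_pdivlMr//.
  apply: partition_sup_le => // s [s0 sE].
  rewrite ler_pdivlMr// mulrC.
  have -> : l * \sum_(y <- s) p y = \sum_(y <- [seq l *: y | y <- s]) p y.
    rewrite big_map mulr_sumr; apply: eq_big_seq => y /(allP s0) y0.
    by rewrite pscale.
  apply: partition_sup_ge; first by rewrite vscale_ge0// ltW.
  split; last by rewrite big_map -scaler_sumr sE.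
  by rewrite all_map; apply/allP => y /(allP s0) y0 /=; rewrite vscale_ge0// ltW.
apply/le_anti; rewrite h// andbT.
have ki0 : 0 < k^-1 by rewrite invr_gt0.
have := h _ _ ki0 (vscale_ge0 _ _ (ltW k0) a0).
by rewrite scalerA mulVf ?gt_eqF// scale1r mulrC ler_pdivrMr// mulrC.
Qed.

Definition partition_ext x : R^o := H (x \join 0) - H ((- x) \join 0).

Lemma partition_extE x a b : 0 <=v a -> 0 <=v b -> x = a - b ->
  partition_ext x = H a - H b.
Proof.
move=> a0 b0 xab.
have xE := vpos_partE x.
have e : (x \join 0) + b = a + ((- x) \join 0).
  move: xE; rewrite {1}xab; move: (x \join 0) ((- x) \join 0) => u v abE.
  by rewrite -[a](subrK b) abE addrAC subrK.
have := partition_supD (vjoin_r x 0) b0; rewrite e partition_supD ?vjoin_r//.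
rewrite /partition_ext; lra.
Qed.

Lemma partition_ext_pos x : 0 <=v x -> partition_ext x = H x.
Proof.
move=> x0; rewrite (@partition_extE x x 0) ?vlexx ?subr0//.
by rewrite partition_sup0 subr0.
Qed.

Lemma partition_ext_linear : linear partition_ext.
Proof.
move=> k x y; change (partition_ext (k *: x + y) =
  k * (partition_ext x : R) + (partition_ext y : R)).
have [x1 y1] := (vjoin_r x 0, vjoin_r y 0).
have [x2 y2] := (vjoin_r (- x) 0, vjoin_r (- y) 0).
have [xE yE] := (vpos_partE x, vpos_partE y).
rewrite (partition_extE x1 x2 xE) (partition_extE y1 y2 yE).
rewrite {1}xE {1}yE; move: x1 x2 y1 y2 {xE yE}.
move: (x \join 0) (- x \join 0) (y \join 0) (- y \join 0) => a b c d a0 b0 c0 d0.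
have [k0|k0] := lerP 0 k.
  rewrite (@partition_extE _ (k *: a + c) (k *: b + d)) ?vadd_ge0 ?vscale_ge0//.
    by rewrite !partition_supD ?partition_supZ ?vscale_ge0//; lra.
  by rewrite scalerBr opprD addrACA.
have Nk0 : 0 <= - k by rewrite oppr_ge0 ltW.
rewrite (@partition_extE _ ((- k) *: b + c) ((- k) *: a + d))
  ?vadd_ge0 ?vscale_ge0//.
  by rewrite !partition_supD ?partition_supZ ?vscale_ge0//; lra.
rewrite !scaleNr [- (_ + d)]opprD opprK scalerBr [RHS]addrACA.
by rewrite [- _ + k *: a]addrC.
Qed.

Lemma partition_ext_bounded : order_bounded partition_ext.
Proof.
have D x y : x <=v y ->
    (partition_ext x : R) - (f x : R) <= (partition_ext y : R) - (f y : R).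
  rewrite -vsubr_ge0 => xy.
  have := fp xy; rewrite dualD dualN.
  have := partition_sup_dominates xy; rewrite -/H -partition_ext_pos//.
  have -> : partition_ext (y - x) =
      -1 * (partition_ext x : R) + (partition_ext y : R) :> R.
    by rewrite addrC -(scaleN1r x); exact: partition_ext_linear.
  lra.
apply: mk_bounded => a b; have [M HM] := dual_boundedP f a b.
exists (M + `|(partition_ext a : R) - (f a : R)|
          + `|(partition_ext b : R) - (f b : R)|) => x ax xb.
have := HM _ ax xb; have := D _ _ ax; have := D _ _ xb.
move: ((partition_ext a : R) - (f a : R)) => c.
move: ((partition_ext b : R) - (f b : R)) => d.
move: (partition_ext x : R) (f x : R) => u v; rewrite !ler_norml => h1 h2 /andP[h3 h4].
have := ler_norm c; have := ler_norm (- c); have := ler_norm d.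
have := ler_norm (- d); rewrite !normrN => *; apply/andP; split; lra.
Qed.

Definition partition_functional : order_dual E :=
  OrderBoundedOperator partition_ext_linear partition_ext_bounded.

Lemma partition_functional_ge x : 0 <=v x -> p x <= partition_functional x.
Proof.
by move=> x0; rewrite /= partition_ext_pos//; exact: partition_sup_dominates.
Qed.

Lemma partition_functional_le (h : order_dual E) :
  (forall x, 0 <=v x -> p x <= (h x : R)) ->
  forall x, 0 <=v x -> (partition_functional x : R) <= (h x : R).
Proof.
move=> ph x x0; rewrite /= partition_ext_pos//.
apply: partition_sup_le => // s [s0 <-] {x x0}.
elim: s s0 => [|y s IH] /=; first by rewrite !big_nil dual0.
by move=> /andP[y0 s0]; rewrite !big_cons dualD lerD ?ph ?IH.
Qed.

End PartitionSup.

Section OrderDualLattice.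
Variables (R : realType) (E : rieszSpaceType R).
Implicit Types (f g h : order_dual E) (x y : E).

Definition dual_le : rel (order_dual E) :=
  fun f g => `[< forall x, 0 <=v x -> (f x : R) <= (g x : R) >].

Fact dual_le_refl : reflexive dual_le.
Proof. by move=> f; apply/asboolP. Qed.

Fact dual_le_anti : antisymmetric dual_le.
Proof.
move=> f g /andP[/asboolP fg /asboolP gf]; apply: ob_ext => x.
have e y : 0 <=v y -> (f y : R) = (g y : R).
  by move=> y0; apply/le_anti; rewrite fg// gf.
change ((f x : R) = (g x : R)).
by rewrite (vpos_partE x) !dualD !dualN !e// vjoin_r.
Qed.

Fact dual_le_trans : transitive dual_le.
Proof.
move=> g f h /asboolP fg /asboolP gh; apply/asboolP => x x0.
by apply: (le_trans (fg x x0)); exact: gh.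
Qed.

Section Join.
Variables f g : order_dual E.
Let p x : R := Num.max (f x : R) (g x : R).

Fact max_sub a b : 0 <=v a -> 0 <=v b -> p (a + b) <= p a + p b.
Proof.
by move=> _ _; rewrite /p !dualD ge_max !lerD// le_max lexx ?orbT.
Qed.

Fact max_scale (k : R) a : 0 < k -> 0 <=v a -> p (k *: a) = k * p a.
Proof. by move=> /ltW k0 _; rewrite /p !dualZ maxr_pMr. Qed.

Fact max_bound x : 0 <=v x ->
  exists M, forall s, partition_of x s -> \sum_(y <- s) p y <= M.
Proof.
move=> x0; have [M HM] := dual_boundedP f 0 x; have [N HN] := dual_boundedP g 0 x.
exists (M + N) => s [s0 sx].
suff key (t : seq E) w : all (vle 0) t ->
    (forall z, 0 <=v z -> z <=v \sum_(y <- t) y ->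
      w + (f z : R) + (g (\sum_(y <- t) y - z) : R) <= M + N) ->
    w + \sum_(y <- t) p y <= M + N.
  have := key s 0 s0; rewrite add0r; apply; rewrite sx => z z0 zx.
  have /(le_trans (ler_norm _)) h1 := HM z z0 zx.
  have /(le_trans (ler_norm _)) h2 : `|g (x - z) : R| <= N.
    apply: HN; first by rewrite vsubr_ge0.
    by rewrite -vsubr_ge0 opprB addrC subrK.
  by rewrite add0r lerD.
elim: t w => [|y t IH] w /=.
  move=> _ /(_ 0 (vlexx _)); rewrite !big_nil subrr !dual0 !addr0; apply.
  exact: vlexx.
move=> /andP[y0 t0] H; rewrite big_cons addrA.
have [e|e] : p y = (f y : R) \/ p y = (g y : R) by rewrite /p; case: ltP; [right|left].
  rewrite e; apply: IH => // z z0 zt.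
  have := H (y + z); rewrite big_cons vadd_ge0// vle_add2l zt => /(_ isT isT).
  by rewrite opprD addrACA subrr add0r dualD; lra.
rewrite e; apply: IH => // z z0 zt.
have := H z; rewrite big_cons z0 => /(_ isT).
rewrite (vle_tr zt); last by rewrite -{1}[\sum_(_ <- _) _]add0r vle_add2r.
by move=> /(_ isT); rewrite -[y + _ - z]addrA dualD; lra.
Qed.

Fact max_ge x : 0 <=v x -> (f x : R) <= p x.
Proof. by rewrite /p le_max lexx. Qed.

Definition dual_join : order_dual E :=
  partition_functional max_sub max_scale max_bound max_ge.

Fact dual_joinP x : 0 <=v x ->
  (f x : R) <= dual_join x /\ (g x : R) <= dual_join x.
Proof.
move=> x0; have := partition_functional_ge max_sub max_scale max_bound max_ge x0.
by rewrite /p ge_max => /andP[].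
Qed.

Fact dual_join_least h :
  (forall x, 0 <=v x -> (f x : R) <= (h x : R)) ->
  (forall x, 0 <=v x -> (g x : R) <= (h x : R)) ->
  forall x, 0 <=v x -> (dual_join x : R) <= (h x : R).
Proof.
move=> fh gh; apply: partition_functional_le => x x0.
by rewrite /p ge_max fh// gh.
Qed.
End Join.

Definition dual_meet f g : order_dual E := - dual_join (- f) (- g).

Fact dual_join_le f g h :
  dual_le (dual_join f g) h = dual_le f h && dual_le g h.
Proof.
apply/idP/andP => [/asboolP H|[/asboolP fh /asboolP gh]].
  by split; apply/asboolP => x x0; have [? ?] := dual_joinP f g x0;
    apply: le_trans (H x x0).
by apply/asboolP; exact: dual_join_least.
Qed.

Fact dual_le_opp f g : dual_le (- f) (- g) = dual_le g f.
Proof.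
by apply/asboolP/asboolP => H x /H; rewrite !dual_oppE lerN2.
Qed.

Fact dual_le_meet f g h :
  dual_le h (dual_meet f g) = dual_le h f && dual_le h g.
Proof. by rewrite -{1}[h]opprK dual_le_opp dual_join_le !dual_le_opp. Qed.

Fact dual_le_add h f g : dual_le f g -> dual_le (h + f) (h + g).
Proof. by move=> /asboolP H; apply/asboolP => x x0; rewrite !dual_addE lerD2l H. Qed.

Fact dual_scale_ge0 (k : R) f : 0 <= k -> dual_le 0 f -> dual_le 0 (k *: f).
Proof.
move=> k0 /asboolP H; apply/asboolP => x x0.
by rewrite dual_scaleE mulr_ge0//; exact: (H x).
Qed.

HB.instance Definition _ :=
  isRieszSpace.Build R (order_dual E) dual_le_refl dual_le_anti dual_le_trans
    dual_le_meet dual_join_le dual_le_add dual_scale_ge0.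

Lemma dual_leP f g :
  reflect (forall x, 0 <=v x -> (f x : R) <= (g x : R)) (f <=v g).
Proof. exact: asboolP. Qed.

End OrderDualLattice.

Section Composition.
Variables (R : realType) (E F G : rieszSpaceType R).
Variables (S : order_bounded_operator F G) (T : order_bounded_operator E F).

Fact ob_comp_linear : linear (S \o T).
Proof. by move=> k x y /=; rewrite !linearP. Qed.

Fact ob_comp_bounded : order_bounded (S \o T).
Proof.
move=> a b; have [c [d cd]] := ob_bounded T a b.
have [c' [d' cd']] := ob_bounded S c d.
by exists c', d' => x ax xb; have [? ?] := cd x ax xb; exact: cd'.
Qed.

Definition ob_comp : order_bounded_operator E G :=
  OrderBoundedOperator ob_comp_linear ob_comp_bounded.
End Composition.

Section OrderAdjoint.
Variables (R : realType) (E F : rieszSpaceType R) (T : order_bounded_operator E F).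
Implicit Types (g h : order_dual F) (x y : E).

Definition adjoint_fun g : order_dual E := ob_comp g T.

Fact adjoint_linear : linear adjoint_fun.
Proof. by move=> k g h; apply: ob_ext. Qed.

(* [T] need not be regular, so [adjoint_fun] is bounded on [[-h, h]] by the
   functional generated by [x |-> h |T x|] rather than by [h \o |T|]. *)
Section Bound.
Variable h : order_dual F.
Hypothesis h0 : 0 <=v h.
Let p x : R := h (modulus (T x)).

Let h_homo u v : u <=v v -> (h u : R) <= (h v : R).
Proof.
rewrite -vsubr_ge0 => /((dual_leP _ _ h0) _).
by rewrite dual_zeroE dualD dualN subr_ge0.
Qed.

Fact adj_sub a b : 0 <=v a -> 0 <=v b -> p (a + b) <= p a + p b.
Proof.
by move=> _ _; rewrite /p -dualD; apply: h_homo; rewrite linearD modulusD.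
Qed.

Fact adj_scale (k : R) a : 0 < k -> 0 <=v a -> p (k *: a) = k * p a.
Proof. by move=> /ltW k0 _; rewrite /p linearZ/= modulusZ// dualZ. Qed.

Fact adj_bound x : 0 <=v x ->
  exists M, forall s, partition_of x s -> \sum_(y <- s) p y <= M.
Proof.
move=> x0; have [c [d cd]] := ob_bounded T (- x) x.
exists (h d) => s [s0 sx].
suff key (t : seq E) w : all (vle 0) t ->
    (forall z, - (\sum_(y <- t) y) <=v z -> z <=v \sum_(y <- t) y ->
      w + T z <=v d) ->
    w + \sum_(y <- t) modulus (T y) <=v d.
  have := key s 0 s0; rewrite add0r sx.
  have -> : \sum_(y <- s) p y = h (\sum_(y <- s) modulus (T y)).
    by elim: (s) => [|y t IH]; rewrite ?big_nil ?dual0// !big_cons dualD IH.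
  by move=> H; apply: h_homo; apply: H => z xz zx; rewrite add0r; have [] := cd z xz zx.
elim: t w => [|y t IH] w /=.
  move=> _; rewrite !big_nil oppr0 => /(_ 0 (vlexx _) (vlexx _)).
  by rewrite linear0.
move=> /andP[y0 t0] H; rewrite big_cons.
have key u : - y <=v u -> u <=v y -> w + T u + \sum_(j <- t) modulus (T j) <=v d.
  move=> yu uy; apply: IH => // z tz zt.
  rewrite -addrA -linearD; apply: H; rewrite big_cons.
    rewrite opprD; apply: (@vle_tr _ _ (u - \sum_(j <- t) j)).
      by rewrite vle_add2r.
    by rewrite vle_add2l.
  apply: (@vle_tr _ _ (u + \sum_(j <- t) j)); first by rewrite vle_add2l.
  by rewrite vle_add2r.
have yNy : - y <=v y.
  by apply: (@vle_tr _ _ 0) => //; rewrite -oppr0 vle_opp.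
have k1 := key _ yNy (vlexx _); have k2 := key _ (vlexx _) yNy.
rewrite addrCA -(vle_add2r (- (w + \sum_(j <- t) modulus (T j)))) addrK.
apply: modulus_le.
  by rewrite -(vle_add2r (w + \sum_(j <- t) modulus (T j))) subrK addrCA addrA.
rewrite -(vle_add2r (w + \sum_(j <- t) modulus (T j))) subrK addrCA addrA.
by rewrite -linearN.
Qed.

Fact adj_ge0 x : 0 <=v x -> ((0 : order_dual E) x : R) <= p x.
Proof. by move=> _; apply: (dual_leP _ _ h0); exact: modulus_ge0. Qed.

Definition adjoint_bound : order_dual E :=
  partition_functional adj_sub adj_scale adj_bound adj_ge0.

Fact adjoint_boundP g : g <=v h -> - g <=v h ->
  adjoint_fun g <=v adjoint_bound /\ - adjoint_fun g <=v adjoint_bound.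
Proof.
move=> /dual_leP gh /dual_leP Ngh.
have key x : 0 <=v x -> `|g (T x) : R| <= adjoint_bound x.
  move=> x0; apply: le_trans (partition_functional_ge _ _ _ _ x0); rewrite /p.
  have h1 : 0 <=v modulus (T x) - T x by rewrite vsubr_ge0 modulus_ge.
  have h2 : 0 <=v modulus (T x) + T x.
    by rewrite -[T x in X in _ + X]opprK vsubr_ge0 modulus_geN.
  have := gh _ h1; have := gh _ h2; have := Ngh _ h1; have := Ngh _ h2.
  rewrite !dual_oppE !dualD !dualN ler_norml => *; apply/andP; split; lra.
split; apply/dual_leP => x x0; apply: le_trans (key x x0).
  exact: ler_norm.
by rewrite dual_oppE -normrN; exact: ler_norm.
Qed.
End Bound.

Fact adjoint_bounded : order_bounded adjoint_fun.
Proof.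
move=> a b; pose h := (b \join (- a)) \join 0.
have h0 : 0 <=v h by exact: vjoin_r.
exists (- adjoint_bound h0), (adjoint_bound h0) => g ag gb.
have [] := @adjoint_boundP h h0 g.
- exact: (vle_tr gb (vle_tr (vjoin_l _ _) (vjoin_l _ _))).
- have Nga : - g <=v - a by rewrite vle_opp.
  exact: (vle_tr Nga (vle_tr (vjoin_r _ _) (vjoin_l _ _))).
by move=> h1 h2; split=> //; rewrite -vle_opp opprK.
Qed.

Definition order_adjoint :
    order_bounded_operator (order_dual F) (order_dual E) :=
  OrderBoundedOperator adjoint_linear adjoint_bounded.

Lemma order_adjointE g x : order_adjoint g x = g (T x).
Proof. by []. Qed.

End OrderAdjoint.

Definition disjointness_preserving (R : realType) (E F : rieszSpaceType R)
    (T : E -> F) : Prop :=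
  forall x y : E, disjoint_vec x y -> disjoint_vec (T x) (T y).

(* Main.v *)
Require Import Defs.
From mathcomp Require Import all_boot all_algebra reals.
From HB Require Import structures.
From mathcomp Require Import order all_classical topology normedtype lra.

(* A Hahn-Banach argument shows that the adjoint of a lattice homomorphism
   [S : E -> F] is interval preserving, hence that its second adjoint preserves
   disjointness. If [T] is disjointness preserving then [x |-> |T x|] is additive
   on the positive cone (Meyer), so it extends to a lattice homomorphism [S] with
   [|T x| <= S |x|]; therefore [|T~~ X| <= S~~ |X|], and disjointness passes from
   [S~~] to [T~~]. Conversely, evaluation [x |-> (f |-> f x)] commutes with the
   modulus and intertwines [T] and [T~~], and it reflects disjointness in [F]
   because the order dual of a Banach lattice separates its points. *)

Set Implicit Arguments.
Unset Strict Implicit.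
Unset Printing Implicit Defensive.
Import Order.TTheory GRing.Theory Num.Theory.
Import numFieldNormedType.Exports.
Local Open Scope classical_set_scope.
Local Open Scope ring_scope.

(** * The Hahn-Banach theorem *)

Section HahnBanach.
Variables (R : realType) (V : lmodType R).
Implicit Types (p q : V -> R) (x y v : V).

Definition sublinear p : Prop :=
  (forall x y, p (x + y) <= p x + p y) /\
  (forall (k : R) x, 0 <= k -> p (k *: x) = k * p x).

Lemma sublinear0 p : sublinear p -> p 0 = 0.
Proof. by move=> [_ ph]; rewrite -(scale0r 0) ph// mul0r. Qed.

(** Supplies the bounds of chains for Zorn's lemma. Subadditivity holds because, of two members of
    [Q], the smaller one can serve for both arguments. *)
Lemma sublinear_inf p (Q : set (V -> R)) : Q !=set0 ->
  (forall q, Q q -> sublinear q) ->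
  (forall q q', Q q -> Q q' -> (forall x, q x <= q' x) \/ (forall x, q' x <= q x)) ->
  (forall x, has_lbound [set q x | q in Q]) ->
  sublinear (fun x => inf [set q x | q in Q]).
Proof.
move=> [q0 Qq0] Qsub Qtot Qlb.
have ne x : [set q x | q in Q] !=set0 by exists (q0 x), q0.
have lb x q : Q q -> inf [set q x | q in Q] <= q x.
  by move=> Qq; apply: ge_inf => //; exists q.
have hle (k : R) x : 0 < k ->
    inf [set q (k *: x) | q in Q] <= k * inf [set q x | q in Q].
  move=> k0; rewrite -ler_pdivrMl//; apply: lb_le_inf => // _ [q Qq <-].
  by rewrite ler_pdivrMl// -((Qsub q Qq).2 _ _ (ltW k0)); exact: lb.
split=> [x y|k x].
  rewrite -lerBlDr; apply: lb_le_inf => // _ [q Qq <-].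
  rewrite lerBlDr -lerBlDl; apply: lb_le_inf => // _ [q' Qq' <-].
  rewrite lerBlDl; have [le|le] := Qtot _ _ Qq Qq'.
    apply: le_trans (lb _ q Qq) _; apply: le_trans ((Qsub q Qq).1 _ _) _.
    by rewrite lerD2l.
  apply: le_trans (lb _ q' Qq') _; apply: le_trans ((Qsub q' Qq').1 _ _) _.
  by rewrite lerD2r.
rewrite le_eqVlt => /predU1P[<-|k0].
  rewrite scale0r mul0r (_ : [set _ | _ in Q] = [set 0]) ?inf1//.
  apply/seteqP; split=> [_ [q Qq <-]|_ ->] /=; first exact: sublinear0 (Qsub _ Qq).
  by exists q0 => //; exact: sublinear0 (Qsub _ Qq0).
apply/le_anti; rewrite hle//=.
have := @hle k^-1 (k *: x); rewrite invr_gt0 => /(_ k0).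
by rewrite scalerA mulVf ?gt_eqF// scale1r ler_pdivlMl.
Qed.

(* Every extension step below lowers [p] by such an infimal convolution with a
   convex cone [C] of pairs [(v, r)]. *)
Lemma sublinear_infconv p (C : V -> R -> Prop) : sublinear p ->
  C 0 0 -> (forall v r v' r', C v r -> C v' r' -> C (v + v') (r + r')) ->
  (forall (k : R) v r, 0 <= k -> C v r -> C (k *: v) (k * r)) ->
  (forall v r, C v r -> 0 <= p v + r) ->
  exists q, [/\ sublinear q, forall x, q x <= p x &
    forall v r, C v r -> forall x, q x <= p (x + v) + r].
Proof.
move=> psub C0 CD CZ Cp.
pose A x : set R := [set s | exists v r, C v r /\ s = p (x + v) + r].
have lb x : has_lbound (A x).
  exists (- p (- x)) => _ [v [r [Cvr ->]]].
  have := Cp _ _ Cvr; have := psub.1 (x + v) (- x).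
  by rewrite addrAC subrr add0r; lra.
have ne x : A x !=set0 by exists (p (x + 0) + 0), 0, 0.
have le x v r : C v r -> inf (A x) <= p (x + v) + r.
  by move=> Cvr; apply: ge_inf => //; exists v, r.
have hle (k : R) x : 0 < k -> inf (A (k *: x)) <= k * inf (A x).
  move=> k0; rewrite -ler_pdivrMl//; apply: lb_le_inf => // _ [v [r [Cvr ->]]].
  have k0' := ltW k0.
  rewrite ler_pdivrMl// mulrDr -(psub.2 _ _ k0') scalerDr; apply: le; exact: CZ.
exists (fun x => inf (A x)); split=> //; last first.
- by move=> v r Cvr x; exact: le.
- by move=> x; have := le x 0 0 C0; rewrite !addr0.
split=> [x y|k x].
  rewrite -lerBlDr; apply: lb_le_inf => // _ [v [r [Cvr ->]]].
  rewrite lerBlDr -lerBlDl; apply: lb_le_inf => // _ [v' [r' [Cvr' ->]]].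
  rewrite lerBlDl; have := le (x + y) _ _ (CD _ _ _ _ Cvr Cvr').
  rewrite addrACA; have := psub.1 (x + v) (y + v'); lra.
rewrite le_eqVlt => /predU1P[<-|k0].
  rewrite scale0r mul0r; apply/le_anti; apply/andP; split.
    by have := le 0 0 0 C0; rewrite !addr0 (sublinear0 psub).
  by apply: lb_le_inf => // _ [v [r [Cvr ->]]]; rewrite add0r Cp.
apply/le_anti; rewrite hle//=.
have := @hle k^-1 (k *: x); rewrite invr_gt0 => /(_ k0).
by rewrite scalerA mulVf ?gt_eqF// scale1r ler_pdivlMl.
Qed.

(** Zorn's lemma for the reversed pointwise order. Infima of chains are finite because a sublinear
    [q] below [p] satisfies [- p (- x) <= q x]. *)
Lemma sublinear_minimal p : sublinear p ->
  exists q, [/\ sublinear q, forall x, q x <= p x &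
    forall q', sublinear q' -> (forall x, q' x <= q x) -> q' = q].
Proof.
move=> psub.
pose P q := sublinear q /\ forall x, q x <= p x; pose D := {q : V -> R | P q}.
pose ge (q q' : D) := `[< forall x, sval q' x <= sval q x >].
have [||||[q [qsub qp]] qmin] := @Zorn D ge.
- by move=> q; apply/asboolP.
- move=> q r s /asboolP h1 /asboolP h2; apply/asboolP => x.
  exact: le_trans (h2 x) (h1 x).
- move=> [q Pq] [r Pr] /asboolP /= rq /asboolP /= qr.
  have qrE : q = r by apply/funext => x; apply/le_anti; rewrite qr rq.
  by subst r; congr exist; exact: Prop_irrelevance.
- move=> A Atot; have [[a Aa]|A0] := pselect (A !=set0); last first.
    by exists (exist P p (conj psub (fun x => lexx _))) => s As; case: A0; exists s.
  pose Q := [set sval q | q in A].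
  have lb x : has_lbound [set q x | q in Q].
    exists (- p (- x)) => _ [_ [[q [qs qp]] _ <-] <-] /=.
    by have := qs.1 x (- x); rewrite subrr (sublinear0 qs); have := qp (- x); lra.
  have Qs : sublinear (fun x => inf [set q x | q in Q]).
    apply: sublinear_inf => //; first by exists (sval a), a.
      by move=> _ [[q [qs qp]] _ <-].
    move=> _ _ [q Aq <-] [r Ar <-].
    have [/asboolP|/asboolP] := Atot q r Aq Ar; by [right|left].
  have le (q : D) x : A q -> inf [set q x | q in Q] <= sval q x.
    by move=> Aq; apply: ge_inf => //; exists (sval q) => //; exists q.
  have Qp x : inf [set q x | q in Q] <= p x.
    by apply: le_trans (le a x Aa) _; exact: (svalP a).2.
  exists (exist P _ (conj Qs Qp)) => q Aq; apply/asboolP => x; exact: le.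
exists q; split=> // q' q's q'q.
have q'p x : q' x <= p x by exact: le_trans (q'q x) (qp x).
have := qmin (exist P q' (conj q's q'p)); rewrite /ge asboolT// => /(_ isT).
by case.
Qed.

Lemma sublinear_dominates p : sublinear p ->
  exists f : {linear V -> R^o}, forall x, (f x : R) <= p x.
Proof.
move=> /sublinear_minimal[q [qsub qp qmin]].
have qD x z : q (x + z) = q x + q z.
  (* The cone is the ray through [(z, - q z)]. Minimality makes the convolution equal to [q], so
     [q x <= q (x + z) - q z], the missing half of additivity. *)
  pose C v r := exists2 t : R, 0 <= t & v = t *: z /\ r = - (t * q z).
  have [||||q' [q's q'q q'C]] := @sublinear_infconv q C qsub.
  - by exists 0 => //; rewrite scale0r mul0r oppr0.
  - move=> _ _ _ _ [t t0 [-> ->]] [u u0 [-> ->]]; exists (t + u).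
      exact: addr_ge0.
    by rewrite scalerDl mulrDl opprD.
  - move=> k _ _ k0 [t t0 [-> ->]]; exists (k * t); first exact: mulr_ge0.
    by rewrite scalerA mulrN mulrA.
  - by move=> _ _ [t t0 [-> ->]]; rewrite qsub.2// subrr.
  have {}q'q := qmin _ q's q'q; subst q'.
  have := q'C z (- q z); case: qsub => qa _.
  have h : C z (- q z) by exists 1 => //; rewrite scale1r mul1r.
  by move=> /(_ h x) ?; apply/le_anti; rewrite qa/=; lra.
have q0 := sublinear0 qsub.
have qN x : q (- x) = - q x by have := qD x (- x); rewrite subrr q0; lra.
have ql : linear (q : V -> R^o).
  move=> k x y; rewrite qD; congr (_ + _).
  have [k0|k0] := lerP 0 k; first exact: qsub.2.
  have := qsub.2 (- k) x; rewrite oppr_ge0 (ltW k0) => /(_ isT).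
  by rewrite scaleNr qN mulNr => /oppr_inj.
pose H := GRing.isLinear.Build R V R^o *:%R q ql.
by exists (HB.pack_for {linear V -> R^o} q H).
Qed.

(** Extension along a map [S] rather than from a subspace, ready for use with a lattice
    homomorphism. Convolving with the pairs [(- S u, psi u)] forces [f (S u) <= psi u], and [- u]
    gives equality. *)
Lemma hahn_banach p (U : lmodType R) (S : {linear U -> V})
    (psi : {linear U -> R^o}) : sublinear p ->
  (forall u, (psi u : R) <= p (S u)) ->
  exists2 f : {linear V -> R^o},
    (forall x, (f x : R) <= p x) & (forall u, f (S u) = psi u).
Proof.
move=> psub psip.
pose C v r := exists u, v = - S u /\ r = psi u.
have [||||q [qs qp qC]] := @sublinear_infconv p C psub.
- by exists 0; rewrite !linear0.
- by move=> _ _ _ _ [u [-> ->]] [w [-> ->]]; exists (u + w); rewrite !linearD.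
- move=> k _ _ k0 [u [-> ->]]; exists (k *: u).
  by rewrite !linearZ/= scalerN.
- move=> _ _ [u [-> ->]]; have := psip (- u); rewrite !linearN.
  by move: (psi u : R) (p (- S u)) => a b; rewrite -[- (a : R^o)]/(- a); lra.
have [f fq] := sublinear_dominates qs.
have le u : (f (S u) : R) <= psi u.
  have := qC _ _ (ex_intro _ u (conj erefl erefl)) (S u).
  by rewrite subrr (sublinear0 psub) add0r; exact: le_trans (fq _).
exists f => [x|u]; first exact: le_trans (fq x) (qp x).
apply/le_anti; rewrite le/=; have := le (- u); rewrite !linearN.
by rewrite (@lerN2 R).
Qed.

Lemma hahn_banach1 p z : sublinear p ->
  exists2 f : {linear V -> R^o}, (forall x, (f x : R) <= p x) & f z = p z.
Proof.
move=> psub.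
have Sl : linear (fun t : R^o => t *: z : V).
  by move=> k s t; rewrite scalerDl scalerA.
have pl : linear (fun t : R^o => (t * p z : R) : R^o).
  by move=> k s t; rewrite mulrDl -mulrA.
pose S : {linear R^o -> V} := HB.pack_for {linear R^o -> V}
  (fun t : R^o => t *: z : V) (GRing.isLinear.Build R R^o V *:%R _ Sl).
pose psi : {linear R^o -> R^o} :=
  HB.pack_for {linear R^o -> R^o} (fun t : R^o => (t * p z : R) : R^o)
    (GRing.isLinear.Build R R^o R^o *:%R _ pl).
have [t|f fp fS] := @hahn_banach p _ S psi psub.
  rewrite /=; have [t0|t0] := lerP 0 (t : R); first by rewrite psub.2.
  (* For [t < 0], use [0 <= p (t *: z) + p (- t *: z)]. *)
  have := psub.2 (- t) z; rewrite oppr_ge0 (ltW t0) => /(_ isT).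
  have := psub.1 (t *: z) ((- t) *: z).
  rewrite -scalerDl subrr scale0r (sublinear0 psub) mulNr => h1 h2.
  by move: h1; rewrite h2; lra.
by exists f => //; have := fS 1; rewrite /= scale1r mul1r.
Qed.

End HahnBanach.

(** * Riesz spaces and Meyer's theorem *)

Definition pos_part (R : realType) (E : rieszSpaceType R) (x : E) : E := x \join 0.

Notation "x ^v+" := (pos_part x) (at level 2, format "x ^v+") : ring_scope.
Notation "x ^v-" := (pos_part (- x)) (at level 2, format "x ^v-") : ring_scope.

Section RieszAlgebra.
Variables (R : realType) (E : rieszSpaceType R).
Implicit Types (a b c d x y z u v w : E).

Lemma vle_subl x y z : (x - y <=v z) = (x <=v z + y).
Proof. by rewrite -(vle_add2r y) subrK. Qed.

Lemma vle_addl a x : 0 <=v a -> x <=v a + x.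
Proof. by rewrite -{1}[x]add0r vle_add2r. Qed.

Lemma vle_addr a x : 0 <=v a -> x <=v x + a.
Proof. by rewrite addrC; exact: vle_addl. Qed.

Lemma vleD a b c d : a <=v b -> c <=v d -> a + c <=v b + d.
Proof.
by move=> ab cd; apply: (@vle_tr _ _ (b + c)); rewrite ?vle_add2r ?vle_add2l.
Qed.

Lemma vmeetC x y : x \meet y = y \meet x.
Proof. by apply: vle_eq; rewrite vle_meet vmeet_l vmeet_r. Qed.

Lemma vmeet_mono a b c d : a <=v b -> c <=v d -> a \meet c <=v b \meet d.
Proof.
move=> ab cd; rewrite vle_meet (vle_tr (vmeet_l _ _) ab).
by rewrite (vle_tr (vmeet_r _ _) cd).
Qed.

Lemma vmeet_ge0 x y : 0 <=v x -> 0 <=v y -> 0 <=v x \meet y.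
Proof. by rewrite vle_meet => -> ->. Qed.

Lemma vmeet_idl x y : x <=v y -> x \meet y = x.
Proof. by move=> xy; apply: vle_eq; rewrite ?vmeet_l// vle_meet vlexx. Qed.

Lemma vadd_meet z x y : z + (x \meet y) = (z + x) \meet (z + y).
Proof.
apply: vle_eq; first by rewrite vle_meet !vle_add2l vmeet_l vmeet_r.
rewrite -(vle_add2l (- z)) addKr vle_meet.
rewrite -(vle_add2l z _ x) -(vle_add2l z _ y) !addrA !addrN !add0r.
by rewrite vmeet_l vmeet_r.
Qed.

Lemma vscale_meet (k : R) x y : 0 < k -> k *: (x \meet y) = (k *: x) \meet (k *: y).
Proof.
have h (l : R) a b : 0 < l -> l *: (a \meet b) <=v (l *: a) \meet (l *: b).
  by move=> /ltW l0; rewrite vle_meet !vle_scale// ?vmeet_l ?vmeet_r.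
move=> k0; apply: vle_eq; first exact: h.
have := @h k^-1 (k *: x) (k *: y); rewrite invr_gt0 => /(_ k0).
move=> /(@vle_scale R E k _ _ (ltW k0)).
by rewrite !scalerA mulVf ?gt_eqF// divff ?gt_eqF// !scale1r.
Qed.

Lemma vmeet_addr_le d a b : 0 <=v d -> 0 <=v a -> 0 <=v b ->
  d \meet (a + b) <=v d \meet a + d \meet b.
Proof.
move=> d0 a0 b0; have db0 := vmeet_ge0 d0 b0.
rewrite [d \meet a + _]addrC vadd_meet vle_meet.
apply/andP; split; first exact: (vle_tr (vmeet_l _ _) (vle_addl _ db0)).
rewrite [_ + a]addrC vadd_meet vle_meet (vle_tr (vmeet_l _ _) (vle_addl _ a0)).
exact: vmeet_r.
Qed.

(** [d = d \meet (a + b)] is at most [d \meet a + d \meet b]. Disjointness of positive vectors is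
    written [_ \meet _ <=v 0], the form that monotonicity delivers. *)
Lemma vle_add_disj d a b : 0 <=v d -> 0 <=v a -> 0 <=v b ->
  d <=v a + b -> d \meet b <=v 0 -> d <=v a.
Proof.
move=> d0 a0 b0 dab db; rewrite -(vmeet_idl dab).
apply: (vle_tr (vmeet_addr_le d0 a0 b0)); rewrite -[a in X in _ <=v X]addr0.
by apply: vleD => //; exact: vmeet_r.
Qed.

Lemma vdisjD d a b : 0 <=v d -> 0 <=v a -> 0 <=v b ->
  d \meet a <=v 0 -> d \meet b <=v 0 -> d \meet (a + b) <=v 0.
Proof.
move=> d0 a0 b0 da db; apply: (vle_tr (vmeet_addr_le d0 a0 b0)).
by rewrite -[0]addr0 vleD.
Qed.

(** Both vectors lie below [1 + k] times [d] and [a], and [1 + k] is positive even for [k = 0], so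
    it factors out of the meet. *)
Lemma vdisjZ (k : R) d a : 0 <= k -> 0 <=v d -> 0 <=v a ->
  d \meet a <=v 0 -> (k *: d) \meet a <=v 0.
Proof.
move=> k0 d0 a0 da; have k1 : 0 < 1 + k by lra.
apply: (@vle_tr _ _ ((1 + k) *: (d \meet a))); last first.
  by rewrite -(scaler0 _ (1 + k)) vle_scale// ltW.
rewrite vscale_meet// !scalerDl !scale1r.
by apply: vmeet_mono; rewrite ?vle_addl ?vle_addr// vscale_ge0.
Qed.

Lemma pos_part_ge0 x : 0 <=v x^v+. Proof. exact: vjoin_r. Qed.

Lemma pos_part_ge x : x <=v x^v+. Proof. exact: vjoin_l. Qed.

Lemma pos_part_le x y : (x^v+ <=v y) = (x <=v y) && (0 <=v y).
Proof. exact: vjoin_le. Qed.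

Lemma pos_negB x : x = x^v+ - x^v-. Proof. exact: vpos_partE. Qed.

Lemma pos_part_id x : 0 <=v x -> x^v+ = x.
Proof. by move=> x0; apply: vle_eq; rewrite ?pos_part_ge// pos_part_le vlexx. Qed.

(** Translation by [- x^v-] turns the claim into [x \meet 0 <=v - x^v-]. *)
Lemma pos_neg_disj x : x^v+ \meet x^v- <=v 0.
Proof.
rewrite -(vle_add2l (- x^v-)) vadd_meet addr0 addNr [- _ + _]addrC -pos_negB.
rewrite -vle_opp opprK pos_part_le vle_opp vmeet_l -vle_opp opprK oppr0.
exact: vmeet_r.
Qed.

Lemma modulus_id x : 0 <=v x -> modulus x = x.
Proof.
move=> x0; apply: vle_eq; last exact: modulus_ge.
by apply: modulus_le; rewrite ?vlexx//; apply: (vle_tr _ x0); rewrite -oppr0 vle_opp.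
Qed.

Lemma modulusN x : modulus (- x) = modulus x.
Proof.
by rewrite /modulus opprK; apply: vle_eq; rewrite vjoin_le vjoin_l vjoin_r.
Qed.

Lemma pos_partD_le x y : (x + y)^v+ <=v x^v+ + y^v+.
Proof. by rewrite pos_part_le vleD ?pos_part_ge// vadd_ge0 ?pos_part_ge0. Qed.

(** [x^v+ <=v modulus (x - z) + (z^v+ + x^v-)], and [d] is disjoint from the last two terms. *)
Lemma vle_modulus_sub d x z : 0 <=v d -> d <=v x^v+ ->
  d \meet x^v- <=v 0 -> d \meet z^v+ <=v 0 -> d <=v modulus (x - z).
Proof.
move=> d0 dx dx' dz; have p0 := @pos_part_ge0.
apply: (@vle_add_disj d _ (z^v+ + x^v-)); rewrite ?modulus_ge0 ?vadd_ge0//.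
  apply: (vle_tr dx); rewrite addrA -vle_subl -pos_negB -vle_subl.
  apply: (vle_tr _ (modulus_ge _)).
  by rewrite vle_add2l vle_opp pos_part_ge.
by apply: vdisjD.
Qed.

Lemma vle_modulusB d a b : 0 <=v d -> 0 <=v b -> d <=v a -> d \meet b <=v 0 ->
  d <=v modulus (a - b).
Proof.
move=> d0 b0 da; apply: vle_add_disj => //; first exact: modulus_ge0.
by apply: (vle_tr da); rewrite -vle_subl modulus_ge.
Qed.

(** The modulus [m] dominates both [a] and [b], so [a + b - m] lies below each of them, hence below
    [a \meet b]. *)
Lemma modulusB_disj a b : 0 <=v a -> 0 <=v b -> a \meet b <=v 0 ->
  modulus (a - b) = a + b.
Proof.
move=> a0 b0 ab; apply: vle_eq.
  apply: modulus_le; first by rewrite vle_add2l -vsubr_ge0 opprK vadd_ge0.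
  by rewrite opprB addrC vle_add2r -vsubr_ge0 opprK vadd_ge0.
have h1 := vle_modulusB a0 b0 (vlexx a) ab.
have h2 : b <=v modulus (a - b).
  by rewrite -modulusN opprB vle_modulusB ?vlexx// vmeetC.
rewrite -[modulus _]add0r -vle_subl; apply: (vle_tr _ ab).
by rewrite vle_meet vle_subl vle_add2l h2 vle_subl addrC vle_add2l h1.
Qed.

Lemma pos_partZ_le (k : R) x : 0 <= k -> (k *: x)^v+ <=v k *: x^v+.
Proof.
move=> k0; rewrite pos_part_le vle_scale ?pos_part_ge//.
by rewrite vscale_ge0 ?pos_part_ge0.
Qed.

Lemma pos_partZ (k : R) x : 0 < k -> (k *: x)^v+ = k *: x^v+.
Proof.
move=> k0; apply: vle_eq; first exact/pos_partZ_le/ltW.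
have ki0 : 0 <= k^-1 by rewrite invr_ge0 ltW.
have := pos_partZ_le (k *: x) ki0; rewrite scalerA mulVf ?gt_eqF// scale1r.
by move=> /(@vle_scale R E k _ _ (ltW k0)); rewrite scalerA divff ?gt_eqF// scale1r.
Qed.

Lemma modulusE x : modulus x = x^v+ + x^v-.
Proof. by rewrite {1}[x]pos_negB modulusB_disj ?pos_part_ge0// pos_neg_disj. Qed.

Lemma pos_partB_disj a b : 0 <=v a -> 0 <=v b -> a \meet b <=v 0 ->
  (a - b)^v+ = a.
Proof.
move=> a0 b0 ab; apply: vle_eq.
  by rewrite pos_part_le a0 andbT vle_subl vle_addr.
apply: (vle_add_disj a0 (pos_part_ge0 _) b0) => //.
by rewrite -vle_subl pos_part_ge.
Qed.

Lemma vdisj_sub_meet x y : (x - x \meet y) \meet (y - x \meet y) <=v 0.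
Proof.
rewrite -(vle_add2l (x \meet y)) vadd_meet addr0.
by rewrite ![x \meet y + _]addrC !subrK vlexx.
Qed.

Lemma disjoint_vec_le0 x y :
  disjoint_vec x y <-> modulus x \meet modulus y <=v 0.
Proof.
rewrite /disjoint_vec; split=> [->|h]; first exact: vlexx.
by apply: vle_eq => //; rewrite vmeet_ge0 ?modulus_ge0.
Qed.

Lemma disjoint_vec_ge0 x y : 0 <=v x -> 0 <=v y ->
  disjoint_vec x y <-> x \meet y <=v 0.
Proof. by move=> x0 y0; rewrite disjoint_vec_le0 !modulus_id. Qed.

End RieszAlgebra.

(** The index [n = 0] forces [0 <=v u]. *)
Definition archimedean (R : realType) (F : rieszSpaceType R) : Prop :=
  forall u v : F, (forall n : nat, n%:R *: v <=v u) -> v <=v 0.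

Section Meyer.
Variables (R : realType) (E F : rieszSpaceType R).
Variable T : order_bounded_operator E F.
Hypothesis archF : archimedean F.
Hypothesis Tdp : disjointness_preserving T.
Implicit Types (x y z : E).

Lemma ob_modulus_bound y : exists2 M : F, 0 <=v M &
  forall z, 0 <=v z -> z <=v y -> modulus (T z) <=v M.
Proof.
have [c [d cd]] := ob_bounded T 0 y.
exists (modulus c + modulus d); first by rewrite vadd_ge0 ?modulus_ge0.
move=> z z0 zy; have [cz zd] := cd z z0 zy; apply: modulus_le.
  apply: (vle_tr zd); apply: (vle_tr (modulus_ge d)).
  by rewrite vle_addl ?modulus_ge0.
apply: (@vle_tr _ _ (- c)); first by rewrite vle_opp.
by apply: (vle_tr (modulus_geN c)); rewrite vle_addr ?modulus_ge0.
Qed.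

(* With [g k = T (x /\ k t y)], the vector [g k] is pointwise equal to [T x] or
   to [k t T y], and moves by at most [t M] at each step: where [T x] and [- T y]
   both exceed [t M], it can never jump from [k t T y] to [T x], so it equals
   [k t T y] for every [k], which contradicts the boundedness of [T] on [[0, x]]. *)
Lemma disjointness_preserving_signs x y : 0 <=v x -> 0 <=v y ->
  (T x)^v+ \meet (T y)^v- <=v 0.
Proof.
move=> x0 y0; set v := _ \meet _.
have [M M0 MP] := ob_modulus_bound y; have [K K0 KP] := ob_modulus_bound x.
have v0 : 0 <=v v by rewrite vmeet_ge0 ?pos_part_ge0.
(* For [t = 1 / n] this reads [n *: v <=v M], to which the Archimedean property applies. *)
suff key (t : R) : 0 < t -> (v - t *: M)^v+ <=v 0.
  apply: (archF (u := M)) => n; case: n => [|n]; first by rewrite scale0r.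
  have t0 : 0 < n.+1%:R^-1 :> R by rewrite invr_gt0 ltr0n.
  have := key _ t0; rewrite pos_part_le => /andP[+ _].
  rewrite vle_subl add0r => /(@vle_scale R F n.+1%:R _ _ (ler0n _ _)).
  by rewrite scalerA divff ?scale1r ?pnatr_eq0.
move=> t0; set w := _^v+; have w0 : 0 <=v w by exact: pos_part_ge0.
have wv : w <=v v
  by rewrite pos_part_le v0 andbT vle_subl vle_addr// vscale_ge0// ltW.
have wa : w <=v (T x)^v+ by exact: vle_tr wv (vmeet_l _ _).
have wb : w <=v (T y)^v- by exact: vle_tr wv (vmeet_r _ _).
have wNa : w \meet (T x)^v- <=v 0.
  exact: vle_tr (vmeet_mono wa (vlexx _)) (pos_neg_disj _).
have wNb : w \meet (T y)^v+ <=v 0.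
  rewrite vmeetC; exact: vle_tr (vmeet_mono (vlexx _) wb) (pos_neg_disj _).
pose c k : R := k%:R * t.
have c0 k : 0 <= c k by rewrite mulr_ge0 ?ler0n// ltW.
pose m k : E := x \meet (c k *: y).
have m0 k : 0 <=v m k by rewrite vmeet_ge0// vscale_ge0.
pose g k : F := T (m k).
(* The pointwise alternative made exact: [x - m k] and [c k *: y - m k] are disjoint, hence so are
   their images. *)
have gdisj k : modulus (T x - g k) \meet modulus (c k *: T y - g k) <=v 0.
  rewrite -linearZ -!linearB; apply/disjoint_vec_le0; apply: Tdp.
  by apply/disjoint_vec_ge0; rewrite ?vsubr_ge0 ?vmeet_l ?vmeet_r// vdisj_sub_meet.
(* The increment of [m] lies in [[0, t y]]; rescaled by [t^-1] it lies in [[0, y]], where [M] is a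
   bound. *)
have gstep k : (g k.+1)^v+ <=v (g k)^v+ + t *: M.
  have -> : g k.+1 = g k + t *: T (t^-1 *: (m k.+1 - m k)).
    by rewrite linearZ/= scalerA divff ?gt_eqF// scale1r linearB addrC subrK.
  rewrite pos_part_le vadd_ge0 ?pos_part_ge0 ?vscale_ge0 ?(ltW t0)// andbT.
  apply: vleD; first exact: pos_part_ge.
  apply: vle_scale; first exact: ltW.
  apply: (vle_tr (modulus_ge _)); apply: MP.
    rewrite vscale_ge0 ?invr_ge0 ?(ltW t0)// vsubr_ge0 vmeet_mono ?vlexx//.
    rewrite -vsubr_ge0 -scalerBl vscale_ge0//.
    by rewrite -mulrBl mulr_ge0 ?(ltW t0)// subr_ge0 ler_nat.
  rewrite -[y in X in _ <=v X]scale1r -(@mulVf _ t) ?gt_eqF// -scalerA.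
  apply: vle_scale; first by rewrite invr_ge0 ltW.
  rewrite vle_subl vadd_meet vle_meet.
  rewrite (vle_tr (vmeet_l _ _)) ?vle_addl ?vscale_ge0 ?(ltW t0)//=.
  by rewrite -scalerDl (_ : t + c k = c k.+1) ?vmeet_r// /c mulrS mulrDl mul1r.
(* No jump occurs. The overlap [d] of [w] with [(g k.+1)^v+] lies below the second modulus of
   [gdisj], as [T y] is negative there, so it is disjoint from the first. Yet [wle] and the
   induction hypothesis put [d] below the first. *)
have gw k : w \meet (g k)^v+ <=v 0.
  elim: k => [|k IH].
    rewrite /g (_ : m 0 = 0) ?linear0 ?pos_part_id ?vlexx ?vmeet_r//.
    by apply: vle_eq => //; rewrite /m /c mul0r scale0r vmeet_r.
  set d := _ \meet _; have d0 : 0 <=v d by rewrite vmeet_ge0 ?pos_part_ge0.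
  have dw : d <=v w by exact: vmeet_l.
  have dg : d <=v (g k.+1)^v+ by exact: vmeet_r.
  have ddisj (z : F) : w \meet z <=v 0 -> d \meet z <=v 0.
    exact: vle_tr (vmeet_mono dw (vlexx _)).
  have d1 : d <=v modulus (c k.+1 *: T y - g k.+1).
    rewrite -modulusN opprB; apply: vle_modulus_sub => //.
      exact: vle_tr (vmeet_mono dg (vlexx _)) (pos_neg_disj _).
    apply: ddisj; apply: (@vle_tr _ _ (w \meet (c k.+1 *: (T y)^v+))).
      by apply: vmeet_mono; rewrite ?vlexx ?pos_partZ_le.
    by rewrite vmeetC; apply: vdisjZ; rewrite ?pos_part_ge0// vmeetC.
  have d2 : d \meet modulus (T x - g k.+1) <=v 0.
    rewrite vmeetC; apply: (vle_tr _ (gdisj k.+1)).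
    by apply: vmeet_mono; rewrite ?vlexx.
  have wle : w <=v modulus (T x - g k.+1) + (g k)^v+.
    rewrite pos_part_le vadd_ge0 ?modulus_ge0 ?pos_part_ge0// andbT.
    rewrite vle_subl -addrA; apply: (vle_tr (vmeet_l _ _)).
    apply: (@vle_tr _ _ (modulus (T x - g k.+1) + (g k.+1)^v+)); last first.
      by rewrite vle_add2l gstep.
    rewrite pos_part_le vadd_ge0 ?modulus_ge0 ?pos_part_ge0// andbT.
    rewrite -[T x](subrK (g k.+1)) vleD ?pos_part_ge//.
    by rewrite addrK modulus_ge.
  have dle : d <=v modulus (T x - g k.+1) + (g k)^v+ by exact: vle_tr dw wle.
  have := vle_add_disj d0 (modulus_ge0 _) (pos_part_ge0 _) dle (ddisj _ IH).
  move=> /(vmeet_mono (vlexx d)); rewrite (vmeet_idl (vlexx d)) => /vle_tr.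
  by apply; exact: d2.
(* As [w] avoids [(g k)^v+], it lies below [modulus (T x - g k)]; so [c k *: w] is disjoint from
   [modulus (c k *: T y - g k)] and is at most [modulus (g k)], which [K] bounds for all [k]. *)
apply: (archF (u := t^-1 *: K)) => n; case: n => [|n].
  by rewrite scale0r vscale_ge0 ?invr_ge0 ?(ltW t0).
set k := n.+1; have ck0 : 0 < c k by rewrite mulr_gt0 ?ltr0n.
have w1 : w <=v modulus (T x - g k) by exact: vle_modulus_sub.
have w2 : (c k *: w) \meet modulus (c k *: T y - g k) <=v 0.
  apply: vdisjZ; rewrite ?modulus_ge0//.
  by apply: (vle_tr _ (gdisj k)); apply: vmeet_mono; rewrite ?vlexx.
have w3 : c k *: w <=v modulus (g k) + modulus (c k *: T y - g k).
  apply: (@vle_tr _ _ (c k *: (T y)^v-)); first exact: vle_scale.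
  rewrite -pos_partZ// pos_part_le vadd_ge0 ?modulus_ge0// andbT scalerN.
  apply: (@vle_tr _ _ (- g k - (c k *: T y - g k))).
    by rewrite opprB addrA addNr add0r vlexx.
  by rewrite vleD ?modulus_geN.
have cw0 := vscale_ge0 _ _ (c0 k) w0.
have := vle_add_disj cw0 (modulus_ge0 _) (modulus_ge0 _) w3 w2.
move=> /vle_tr -/(_ _ (KP _ (m0 k) (vmeet_l _ _))).
have ti0 : 0 <= t^-1 by rewrite invr_ge0 ltW.
move=> /(vle_scale ti0); rewrite scalerA /c mulrCA mulVf ?gt_eqF// mulr1.
exact.
Qed.

(** By the sign lemma, the sum of the positive parts of [T x] and [T y] is disjoint from the sum of
    their negative parts. *)
Lemma modulus_additive x y : 0 <=v x -> 0 <=v y ->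
  modulus (T (x + y)) = modulus (T x) + modulus (T y).
Proof.
move=> x0 y0; have p0 := @pos_part_ge0 R F.
have -> : T (x + y) = ((T x)^v+ + (T y)^v+) - ((T x)^v- + (T y)^v-).
  by rewrite opprD addrACA -!pos_negB linearD.
rewrite modulusB_disj ?vadd_ge0//; first by rewrite !modulusE addrACA.
apply: vdisjD; rewrite ?vadd_ge0// vmeetC; apply: vdisjD => //; rewrite vmeetC.
- exact: pos_neg_disj.
- exact: disjointness_preserving_signs.
- exact: disjointness_preserving_signs.
- exact: pos_neg_disj.
Qed.

End Meyer.

(** * Positive operators and functionals *)

Section PositiveOperators.
Variables (R : realType) (E F : rieszSpaceType R).

Lemma positive_order_bounded (f : {linear E -> F}) :
  (forall x, 0 <=v x -> 0 <=v f x) -> order_bounded f.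
Proof.
move=> f0 a b; exists (f a), (f b) => x ax xb.
by split; rewrite -vsubr_ge0 -linearB f0// vsubr_ge0.
Qed.

(** [A u - A v] depends only on [u - v], so linearity is checked on any convenient positive
    decomposition; a negative scalar swaps the two parts. *)
Lemma cone_extension (A : E -> F) :
  (forall x y, 0 <=v x -> 0 <=v y -> A (x + y) = A x + A y) ->
  (forall (k : R) x, 0 <= k -> 0 <=v x -> A (k *: x) = k *: A x) ->
  (forall x, 0 <=v x -> 0 <=v A x) ->
  exists S : order_bounded_operator E F, forall x, 0 <=v x -> S x = A x.
Proof.
move=> AD AZ A0; have p0 := @pos_part_ge0 R E.
pose f x := A x^v+ - A x^v-.
have fE x u v : 0 <=v u -> 0 <=v v -> x = u - v -> f x = A u - A v.
  move=> u0 v0 xuv; have e : x^v+ + v = u + x^v-.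
    have := pos_negB x; rewrite {1}xuv; move: x^v+ x^v- => p q uvE.
    by rewrite -[u](subrK v) uvE addrAC subrK.
  have := AD _ _ (p0 x) v0; rewrite e AD// => h.
  by rewrite /f -[A x^v+](addrK (A v)) -h addrAC addrK.
have A00 : A 0 = 0 by rewrite -(scale0r 0) AZ ?vlexx// scale0r.
have fpos x : 0 <=v x -> f x = A x.
  by move=> x0; rewrite (fE x x 0) ?vlexx ?subr0// A00 subr0.
have flin : linear f.
  move=> k x y; have [k0|k0] := lerP 0 k.
    rewrite (fE _ (k *: x^v+ + y^v+) (k *: x^v- + y^v-)) ?vadd_ge0 ?vscale_ge0//.
      by rewrite !AD ?AZ ?vscale_ge0// /f scalerBr opprD addrACA.
    by rewrite opprD addrACA -scalerBr -!pos_negB.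
  have Nk0 : 0 <= - k by rewrite oppr_ge0 ltW.
  rewrite (fE _ (- k *: x^v- + y^v+) (- k *: x^v+ + y^v-)) ?vadd_ge0 ?vscale_ge0//.
    rewrite !AD ?AZ ?vscale_ge0// /f opprD addrACA !scaleNr opprK scalerBr.
    by rewrite [- _ + k *: _]addrC.
  by rewrite opprD addrACA !scaleNr opprK [- _ + k *: _]addrC -scalerBr -!pos_negB.
pose fl : {linear E -> F} := HB.pack_for {linear E -> F} f
  (GRing.isLinear.Build R E F *:%R f flin).
have fb : order_bounded f.
  by apply: (@positive_order_bounded fl) => x x0 /=; rewrite fpos// A0.
by exists (OrderBoundedOperator flin fb).
Qed.

(** [T] sends [x^v+] and [x^v-] to disjoint vectors, so their moduli are the positive and negative
    parts of [S x]. *)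
Lemma lattice_hom_modulus (T : order_bounded_operator E F) :
  archimedean F -> disjointness_preserving T ->
  exists S : order_bounded_operator E F,
    (forall x, S x^v+ = (S x)^v+) /\ forall x, modulus (T x) <=v S (modulus x).
Proof.
move=> archF Tdp.
have [||x _|S SE] := @cone_extension (fun x => modulus (T x)).
- exact: modulus_additive.
- by move=> k x k0 _; rewrite linearZ/= modulusZ.
- exact: modulus_ge0.
have p0 := @pos_part_ge0 R E.
exists S; split=> x.
  have -> : S x = S x^v+ - S x^v- by rewrite -linearB -pos_negB.
  rewrite !SE// pos_partB_disj ?modulus_ge0//.
  by apply/disjoint_vec_le0/Tdp/disjoint_vec_ge0; rewrite ?pos_neg_disj.
have -> : T x = T x^v+ - T x^v- by rewrite -linearB -pos_negB.
rewrite [modulus x]modulusE linearD /= !SE//.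
by apply: (vle_tr (modulusD _ _)); rewrite modulusN vlexx.
Qed.

End PositiveOperators.

Section PositiveFunctionals.
Variables (R : realType) (E : rieszSpaceType R).
Implicit Types (f g phi psi : order_dual E) (x y u : E).

Lemma dual_ge0 phi x : 0 <=v phi -> 0 <=v x -> 0 <= (phi x : R).
Proof. by move=> /dual_leP h /h. Qed.

Lemma dual_homo phi x y : 0 <=v phi -> x <=v y -> (phi x : R) <= (phi y : R).
Proof.
by move=> p0; rewrite -vsubr_ge0 => /(dual_ge0 p0); rewrite dualD dualN subr_ge0.
Qed.

(** Add [f <=v modulus f] at [y + x] to [- f <=v modulus f] at [y - x]. *)
Lemma dual_le_modulus f x y :
  x <=v y -> - x <=v y -> (f x : R) <= modulus f y.
Proof.
rewrite -vsubr_ge0 => yx; rewrite -vsubr_ge0 opprK => yNx.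
have /dual_leP/(_ _ yNx) := modulus_ge f; have /dual_leP/(_ _ yx) := modulus_geN f.
rewrite dual_oppE !dualD !dualN.
move: (modulus f y : R) (modulus f x : R) (f x : R) (f y : R) => a b c d; lra.
Qed.

Lemma dual_pos_part_sublinear phi : 0 <=v phi ->
  sublinear (fun x => phi x^v+ : R).
Proof.
move=> p0; split=> [x y|k x].
  by rewrite -dualD; apply: dual_homo => //; exact: pos_partD_le.
rewrite le_eqVlt => /predU1P[<-|k0]; last by rewrite pos_partZ// dualZ.
by rewrite scale0r mul0r pos_part_id ?vlexx// dual0.
Qed.

(** Positivity: for [0 <=v x] the bound at [- x] is [phi 0 = 0]. *)
Lemma dual_of_le_pos_part (f : {linear E -> R^o}) phi : 0 <=v phi ->
  (forall x, (f x : R) <= phi x^v+) ->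
  exists g, [/\ g =1 f, 0 <=v g & g <=v phi].
Proof.
move=> p0 fp.
have f0 x : 0 <=v x -> (0 : R) <= f x.
  move=> x0; have := fp (- x); rewrite linearN.
  have -> : (- x)^v+ = 0.
    apply: vle_eq; last exact: pos_part_ge0.
    by rewrite pos_part_le vlexx andbT -vle_opp opprK oppr0.
  by rewrite dual0 oppr_le0.
have fb : order_bounded f by exact: positive_order_bounded f0.
exists (OrderBoundedOperator (@linearP _ _ _ _ f) fb); split=> //.
  by apply/dual_leP => x x0; exact: f0.
by apply/dual_leP => x x0; have := fp x; rewrite pos_part_id.
Qed.

Lemma dual_attains_pos_part phi x : 0 <=v phi ->
  exists g, [/\ 0 <=v g, g <=v phi & (g x : R) = phi x^v+].
Proof.
move=> p0; have [f fp fx] := hahn_banach1 x (dual_pos_part_sublinear p0).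
by have [g [gE g0 gp]] := dual_of_le_pos_part p0 fp; exists g; split; rewrite ?gE.
Qed.

(** One half of the Riesz-Kantorovich formula: [(f \meet g) u] is the infimum of [f u1 + g u2] over
    positive splittings of [u]. *)
Lemma dual_meet_split f g u (e : R) : f \meet g <=v 0 -> 0 <=v u -> 0 < e ->
  exists u1 u2, [/\ 0 <=v u1, 0 <=v u2, u = u1 + u2 & (f u1 : R) + (g u2 : R) < e].
Proof.
move=> /dual_leP fg u0 e0; apply: contrapT => nsplit.
have : (dual_join (- f) (- g) u : R) <= - e.
  have -> : (dual_join (- f) (- g) u : R) =
      partition_sup (fun x => Num.max ((- f) x : R) ((- g) x)) u.
    exact: partition_ext_pos (@max_sub _ _ _ _) (@max_bound _ _ _ _) _ u0.
  apply: partition_sup_le => // s [s0 sE].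
  rewrite lerNr leNgt; apply/negP => lt; apply: nsplit.
  suff [u1 [u2 [u10 u20 sE' sp]]] : exists u1 u2, [/\ 0 <=v u1, 0 <=v u2,
      \sum_(y <- s) y = u1 + u2 &
      \sum_(y <- s) Num.max ((- f) y : R) ((- g) y) = - ((f u1 : R) + (g u2 : R))].
    by exists u1, u2; split; rewrite // -?sE// -[X in X < _]opprK -sp.
  (* Each piece [y] goes to [u1] or [u2] according to whether [- f] or [- g] realises the maximum at
     [y]. *)
  elim: s s0 {sE lt} => [_|y s IH].
    by exists 0, 0; rewrite vlexx !big_nil addr0 !dual0 addr0 oppr0.
  rewrite [all _ _]/= => /andP[y0 /IH[u1 [u2 [u10 u20 sE sp]]]].
  rewrite !big_cons sE sp.
  rewrite !dual_oppE; case: lerP => _.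
    exists u1, (y + u2); rewrite vadd_ge0// addrCA; split=> //.
    by rewrite dualD; lra.
  exists (y + u1), u2; rewrite vadd_ge0// addrA; split=> //.
  by rewrite dualD; lra.
have := fg _ u0; rewrite -[_ \meet _]/(- dual_join (- f) (- g)) dual_oppE dual_zeroE.
move: (dual_join _ _ u : R) => s; lra.
Qed.

(** Converse of [dual_meet_split]; together they turn disjointness of functionals into approximate
    splittings of positive vectors. *)
Lemma dual_meet_le0 f g :
  (forall u (e : R), 0 <=v u -> 0 < e -> exists u1 u2,
    [/\ 0 <=v u1, 0 <=v u2, u = u1 + u2 & (f u1 : R) + (g u2 : R) < e]) ->
  f \meet g <=v 0.
Proof.
move=> split_fg; apply/dual_leP => u u0; rewrite dual_zeroE.
apply/ler_addgt0Pr => e e0; rewrite add0r.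
have [u1 [u2 [u10 u20 -> lt]]] := split_fg u e u0 e0; rewrite dualD.
have /dual_leP/(_ _ u10) := vmeet_l f g; have /dual_leP/(_ _ u20) := vmeet_r f g.
move: lt; move: ((f \meet g) u1 : R) ((f \meet g) u2 : R) (f u1 : R) (g u2 : R).
by move=> a b c d; lra.
Qed.

End PositiveFunctionals.

(** * Second adjoints *)

Section Bidual.
Variables (R : realType) (E : rieszSpaceType R).
Implicit Types (f g phi : order_dual E) (x y w : E).

Fact bidual_eval_linear x : linear (fun f : order_dual E => f x : R^o).
Proof. by []. Qed.

Fact bidual_eval_bounded x : order_bounded (fun f : order_dual E => f x : R^o).
Proof.
move=> a b; have p0 := @pos_part_ge0 R E.
exists ((a x^v+ : R) - (b x^v- : R)), ((b x^v+ : R) - (a x^v- : R)).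
move=> f /dual_leP af /dual_leP fb.
have -> : f x = (f x^v+ : R) - (f x^v- : R) :> R.
  by rewrite {1}[x]pos_negB dualD dualN.
by split; apply: (@lerB R); rewrite ?af ?fb.
Qed.

Definition bidual_eval x : order_dual (order_dual E) :=
  OrderBoundedOperator (bidual_eval_linear x) (bidual_eval_bounded x).

Lemma bidual_evalE x f : bidual_eval x f = f x.
Proof. by []. Qed.

Lemma modulus_bidual_eval x : modulus (bidual_eval x) = bidual_eval (modulus x).
Proof.
apply: vle_eq.
  apply: modulus_le; apply/dual_leP => phi phi0.
    by rewrite !bidual_evalE; apply: dual_homo => //; exact: modulus_ge.
  rewrite dual_oppE !bidual_evalE -dualN; apply: dual_homo => //.
  exact: modulus_geN.
apply/dual_leP => phi phi0; rewrite bidual_evalE.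
have [g [g0 gphi gx]] := dual_attains_pos_part x phi0.
(* [g + g - phi] lies in [[- phi, phi]], and [g x = phi x^v+]. *)
have -> : (phi (modulus x) : R) = bidual_eval x (g + g - phi).
  rewrite bidual_evalE !dual_addE dual_oppE gx modulusE.
  have -> : phi x = (phi x^v+ : R) - (phi x^v- : R) :> R.
    by rewrite {1}[x]pos_negB dualD dualN.
  by rewrite dualD; lra.
apply: dual_le_modulus.
  by rewrite vle_subl vleD.
rewrite opprB vle_subl.
by rewrite vle_addr// vadd_ge0.
Qed.

Lemma bidual_eval_disjoint x y :
  disjoint_vec x y -> disjoint_vec (bidual_eval x) (bidual_eval y).
Proof.
move=> /disjoint_vec_le0 xy; apply/disjoint_vec_le0.
rewrite !modulus_bidual_eval; move: xy (modulus_ge0 x) (modulus_ge0 y).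
move: (modulus x) (modulus y) => a b ab a0 b0.
apply: dual_meet_le0 => phi e phi0 e0.
(* Disjointness gives [(b - a)^v+ = b], so [g (b - a) = phi b], that is, [g a + (phi - g) b = 0]. *)
have [g [g0 gphi gx]] := dual_attains_pos_part (b - a) phi0.
exists g, (phi - g); rewrite vsubr_ge0 addrC subrK; split=> //.
move: gx; rewrite pos_partB_disj//; last by rewrite vmeetC.
by rewrite !bidual_evalE dual_addE dual_oppE dualD dualN; lra.
Qed.

(** A splitting of [phi] that is small on [modulus x] and [modulus y] respectively makes [phi] small
    on their meet. *)
Lemma bidual_eval_disjoint_inv x y :
  (forall w, 0 <=v w -> (forall phi, 0 <=v phi -> (phi w : R) <= 0) -> w = 0) ->
  disjoint_vec (bidual_eval x) (bidual_eval y) -> disjoint_vec x y.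
Proof.
move=> sep /disjoint_vec_le0; rewrite !modulus_bidual_eval => Jxy.
apply: sep => [|phi phi0]; first by rewrite vmeet_ge0 ?modulus_ge0.
apply/ler_addgt0Pr => e e0; rewrite add0r.
have [u1 [u2 [u10 u20 -> lt]]] := dual_meet_split Jxy phi0 e0.
have h1 := dual_homo u10 (vmeet_l (modulus x) (modulus y)).
have h2 := dual_homo u20 (vmeet_r (modulus x) (modulus y)).
by rewrite dual_addE ltW//; apply: le_lt_trans lt; exact: lerD.
Qed.

End Bidual.

Section AdjointOfLatticeHom.
Variables (R : realType) (E F : rieszSpaceType R).

(* The adjoint of a lattice homomorphism is interval preserving: the functional
   [S x |-> psi x] is dominated by [y |-> phi y^+] on the range of [S]. *)
Lemma order_adjoint_lift (S : order_bounded_operator E F)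
    (phi : order_dual F) (psi : order_dual E) :
  (forall x, S x^v+ = (S x)^v+) -> 0 <=v phi -> 0 <=v psi ->
  psi <=v order_adjoint S phi ->
  exists phi1, [/\ 0 <=v phi1, phi1 <=v phi & order_adjoint S phi1 = psi].
Proof.
move=> Spos phi0 psi0 /dual_leP psile.
have [|f fle fS] := @hahn_banach _ _ _ _ S psi (dual_pos_part_sublinear phi0).
  move=> x; rewrite -Spos; apply: le_trans (psile _ (pos_part_ge0 x)).
  by apply: dual_homo => //; exact: pos_part_ge.
have [g [gE g0 gphi]] := dual_of_le_pos_part phi0 fle.
by exists g; split=> //; apply: ob_ext => x; rewrite order_adjointE gE; exact: fS.
Qed.

Lemma bidual_disjointness_preserving (T S : order_bounded_operator E F) :
  (forall x, S x^v+ = (S x)^v+) -> (forall x, modulus (T x) <=v S (modulus x)) ->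
  disjointness_preserving (order_adjoint (order_adjoint T)).
Proof.
move=> Spos TS X Y /disjoint_vec_le0 XY; apply/disjoint_vec_le0.
(* Passing [modulus (T x) <=v S (modulus x)] to adjoints puts [order_adjoint T psi] in the order
   interval of radius [order_adjoint S psi]. *)
have dom Z phi : 0 <=v phi ->
    (modulus (order_adjoint (order_adjoint T) Z) phi : R) <=
    modulus Z (order_adjoint S phi).
  move=> phi0; suff /dual_leP/(_ _ phi0) :
      modulus (order_adjoint (order_adjoint T) Z) <=v
      order_adjoint (order_adjoint S) (modulus Z) by [].
  have TSphi psi : 0 <=v psi ->
      order_adjoint T psi <=v order_adjoint S psi /\
      - order_adjoint T psi <=v order_adjoint S psi.
    move=> psi0; split; apply/dual_leP => x x0; rewrite ?dual_oppE !order_adjointE.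
      apply: dual_homo => //; apply: (vle_tr (modulus_ge _)).
      by rewrite -{2}(modulus_id x0).
    rewrite -dualN; apply: dual_homo => //; apply: (vle_tr (modulus_geN _)).
    by rewrite -{2}(modulus_id x0).
  apply: modulus_le; apply/dual_leP => psi psi0; have [h1 h2] := TSphi _ psi0.
    by rewrite !order_adjointE; exact: dual_le_modulus.
  rewrite dual_oppE !order_adjointE -dualN; apply: dual_le_modulus => //.
  by rewrite opprK.
apply: dual_meet_le0 => phi e phi0 e0.
have S0 x : 0 <=v x -> 0 <=v S x.
  by move=> x0; rewrite -(pos_part_id x0) Spos pos_part_ge0.
have Sphi0 : 0 <=v order_adjoint S phi.
  by apply/dual_leP => x x0; exact: dual_ge0 phi0 (S0 x x0).
have [u1 [u2 [u10 u20 uE lt]]] := dual_meet_split XY Sphi0 e0.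
have u1le : u1 <=v order_adjoint S phi by rewrite uE vle_addr.
(* The splitting of [order_adjoint S phi] lifts to one of [phi]: [phi1] goes to [u1], so
   [phi - phi1] goes to [u2]. *)
have [phi1 [phi10 phi1le phi1E]] := order_adjoint_lift Spos phi0 u10 u1le.
have phi20 : 0 <=v phi - phi1 by rewrite vsubr_ge0.
have phi2E : order_adjoint S (phi - phi1) = u2.
  have -> : order_adjoint S (phi - phi1) =
      order_adjoint S phi - order_adjoint S phi1 by exact: linearB.
  by rewrite phi1E uE addrC addKr.
exists phi1, (phi - phi1); split=> //; first by rewrite addrC subrK.
apply: le_lt_trans lt; rewrite -phi1E -phi2E.
by apply: lerD; exact: dom.
Qed.

End AdjointOfLatticeHom.

(** * Archimedean property and separation by positive functionals in Banach lattices *)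

Section BanachLattice.
Variables (R : realType) (F : banachLatticeType R).
Implicit Types (u v w x : F).

Lemma norm_homo u v : 0 <=v u -> u <=v v -> `|u| <= `|v|.
Proof.
by move=> u0 uv; apply: norm_monotone; rewrite !modulus_id//; exact: vle_tr uv.
Qed.

(** Monotonicity of the norm gives [n * |v^v+| <= |u^v+|] in norm for every [n], which forces
    [v^v+ = 0]. *)
Lemma banach_lattice_archimedean : archimedean F.
Proof.
move=> u v nv; apply: (vle_tr (pos_part_ge v)).
suff /eqP : `|v^v+| = 0 by rewrite normr_eq0 => /eqP ->; exact: vlexx.
apply/eqP; apply/negPn/negP => vn0.
have v0 : 0 < `|v^v+| by rewrite lt0r vn0 normr_ge0.
have := archi_boundP (divr_ge0 (normr_ge0 u^v+) (ltW v0)).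
set n := Num.bound _; rewrite ltr_pdivrMr// ltNge => /negP; apply.
have [->|n0] := posnP n; first by rewrite mul0r.
rewrite -[n%:R]ger0_norm// -normrZ; apply: norm_homo.
  by rewrite vscale_ge0 ?ler0n ?pos_part_ge0.
rewrite -pos_partZ ?ltr0n// pos_part_le pos_part_ge0 andbT.
exact: vle_tr (nv n) (pos_part_ge u).
Qed.

(** A Hahn-Banach functional [g] norming [w] is order bounded because the norm is monotone, and its
    positive part is at least the norm at [w]. *)
Lemma banach_lattice_dual_separating w : 0 <=v w ->
  (forall phi : order_dual F, 0 <=v phi -> (phi w : R) <= 0) -> w = 0.
Proof.
move=> w0 wphi.
have normsub : sublinear (fun x : F => `|x|).
  by split=> [x y|k x k0]; rewrite ?ler_normD// normrZ ger0_norm.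
have [f fle fw] := hahn_banach1 w normsub.
have fb : order_bounded f.
  apply: mk_bounded => a b; exists `|modulus a + modulus b| => x ax xb.
  have fx : `|f x : R| <= `|x|.
    by rewrite ler_norml fle lerNl; have := fle (- x); rewrite linearN normrN => ->.
  apply: (le_trans fx); apply: norm_monotone.
  rewrite [modulus (_ + _)]modulus_id ?vadd_ge0 ?modulus_ge0//; apply: modulus_le.
    apply: (vle_tr xb); apply: (vle_tr (modulus_ge b)).
    by rewrite vle_addl ?modulus_ge0.
  apply: (@vle_tr _ _ (- a)); first by rewrite vle_opp.
  by apply: (vle_tr (modulus_geN a)); rewrite vle_addr ?modulus_ge0.
pose g : order_dual F := OrderBoundedOperator (@linearP _ _ _ _ f) fb.
apply/eqP; rewrite -normr_le0 -fw; apply: le_trans (wphi g^v+ (pos_part_ge0 g)).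
by have /dual_leP := pos_part_ge g; exact.
Qed.

End BanachLattice.

Theorem corollary2p2 (R : realType) (E : rieszSpaceType R)
    (F : banachLatticeType R) (T : order_bounded_operator E F) :
  disjointness_preserving T <->
  disjointness_preserving (order_adjoint (order_adjoint T)).
Proof.
split=> [Tdp|TTdp x y xy].
  have [S [Spos TS]] := lattice_hom_modulus (@banach_lattice_archimedean R F) Tdp.
  exact: bidual_disjointness_preserving Spos TS.
apply: bidual_eval_disjoint_inv; first exact: banach_lattice_dual_separating.
have TJ z : bidual_eval (T z) = order_adjoint (order_adjoint T) (bidual_eval z).
  exact: ob_ext.
by rewrite !TJ; apply: TTdp; exact: bidual_eval_disjoint.
Qed.
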